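(* Suppose $G=\mathrm{SL}(2)$, let $\alpha$ be the positive coroot of $G$, and let $m$ be a positive integer. If $m$ is even, $(\mathsf{Gr}_0^{m\alpha})^\iota$ is empty. If $m$ is odd, there is an isomorphism of varieties $$(\mathsf{Gr}_0^{m\alpha})^\iota\cong\mathcal{O}_{(2m)}^{\mathrm{C}_m}\cap\mathcal{S}_{(m,m)}^{\mathrm{C}_m},$$ where $\mathcal{O}_{(2m)}^{\mathrm{C}_m}$ denotes the regular nilpotent orbit in the symplectic Lie algebra $\mathfrak{sp}(2m)$, and $\mathcal{S}_{(m,m)}^{\mathrm{C}_m}$ denotes the Slodowy slice to an orbit of Jordan type $(m,m)$ in $\mathfrak{sp}(2m)$.
   Context: Everything is over $\mathbb{C}$. $G[t,t^{-1}]=G(\mathbb{C}[t,t^{-1}])$ etc. $\mathsf{Gr}=G[t,t^{-1}]/G[t]$; $G[t^{-1}]_1=\ker(G[t^{-1}]\to G,\ t^{-1}\mapsto0)$ is identified with $\mathsf{Gr}_0=G[t^{-1}]_1G[t]/G[t]\subset\mathsf{Gr}$ via $g\mapsto gG[t]$. With $t^{m\alpha}=\mathrm{diag}(t^m,t^{-m})$, $\mathsf{Gr}^{m\alpha}=G[t]t^{m\alpha}G[t]/G[t]$ and $\mathsf{Gr}_0^{m\alpha}=\mathsf{Gr}^{m\alpha}\cap\mathsf{Gr}_0$. The involution $\iota$ of $\mathsf{Gr}_0=G[t^{-1}]_1$ is $\iota(g(t^{-1}))=g(-t^{-1})^{-1}$; it preserves $\mathsf{Gr}_0^{m\alpha}$,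 and $(\mathsf{Gr}_0^{m\alpha})^\iota$ denotes its fixed-point subvariety. The Slodowy slice at a nilpotent element $x$ of a semisimple Lie algebra $\mathfrak{g}$ is the affine space $x+\ker(\mathrm{ad}\,y)\subset\mathfrak{g}$, where $(x,h,y)$ is an $\mathfrak{sl}_2$-triple in $\mathfrak{g}$. Jordan types refer to the standard representation $\mathbb{C}^{2m}$; $\mathcal{O}_{(2m)}^{\mathrm{C}_m}$ consists of the nilpotent elements of $\mathfrak{sp}(2m)$ with a single Jordan block. *)

(* Defs.v *)
From HB Require Import structures.
From mathcomp Require Import all_boot all_order all_algebra.
From mathcomp Require Import fraction mpoly.
From mathcomp Require Import classical_sets reals complex.
Set Implicit Arguments.
Unset Strict Implicit.
Unset Printing Implicit Defensive.
Import GRing.Theory.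
Local Open Scope classical_set_scope.
Local Open Scope ring_scope.

(* Varieties are (locally closed) subsets [X] of an ambient set [T] carrying
   affine coordinates [c : I -> T -> F], with the reduced structure.  The index
   type [I] may be infinite, so that [T] can be an ind-affine space; a
   polynomial function only involves the finitely many coordinates [s k].     *)
Section Varieties.
Variable F : fieldType.

Section RegularFunctions.
Variables (I T : Type) (c : I -> T -> F).

Definition point_coords n (s : 'I_n -> I) (x : T) : 'I_n -> F :=
  fun k => c (s k) x.

(* The principal open subset of [X] where [q] does not vanish is the required
   neighbourhood of [x]. *)
Definition regular_at (X : set T) (f : T -> F) (x : T) : Prop :=
  exists (n : nat) (s : 'I_n -> I) (p q : {mpoly F[n]}),
    q.@[point_coords s x] != 0 /\
    forall y, X y -> q.@[point_coords s y] != 0 ->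
      f y = p.@[point_coords s y] / q.@[point_coords s y].

Definition regular_on (X : set T) (f : T -> F) : Prop :=
  forall x, X x -> regular_at X f x.

End RegularFunctions.

Variables (I T J U : Type) (c : I -> T -> F) (d : J -> U -> F).

Definition regular_map (X : set T) (Y : set U) (f : T -> U) : Prop :=
  (forall x, X x -> Y (f x)) /\
  (forall j : J, regular_on c X (fun x => d j (f x))).

End Varieties.

Definition isomorphic_varieties (F : fieldType) (I T J U : Type)
    (c : I -> T -> F) (d : J -> U -> F) (X : set T) (Y : set U) : Prop :=
  exists (f : T -> U) (g : U -> T),
    [/\ regular_map c d X Y f, regular_map d c Y X g,
        (forall x, X x -> g (f x) = x) & (forall y, Y y -> f (g y) = y)].

(* C[t, t^-1] is viewed inside C(t), the fraction field of C[t]. *)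
Section AffineGrassmannian.
Variable F : fieldType.

Notation K := {fraction {poly F}}.

Definition tvar : K := tofrac 'X.

(* G[t] for G = SL(2); [tofrac] embeds C[t] in C(t). *)
Definition Gt : set 'M[K]_2 :=
  [set A | \det A = 1 /\ exists B : 'M[{poly F}]_2, A = map_mx (@tofrac _) B].

(* The point g G[t] of Gr *)
Definition cosetGt (g : 'M[K]_2) : set 'M[K]_2 := [set g *m b | b in Gt].

(* t^{m alpha} = diag (t^m, t^-m) *)
Definition tpow (m : nat) : 'M[K]_2 :=
  \matrix_(i < 2, j < 2)
    if i == j then (if i == ord0 then tvar ^+ m else tvar ^- m) else 0.

Definition Gr_orbit (m : nat) : set (set 'M[K]_2) :=
  [set cosetGt (a *m tpow m) | a in Gt].

(* Elements of G[t^-1] are written as matrices of polynomials in s = t^-1. *)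
Definition Gtinv1 : set 'M[{poly F}]_2 :=
  [set g | \det g = 1 /\ map_mx (fun p => p.[0]) g = 1%:M].

Definition at_tinv (g : 'M[{poly F}]_2) : 'M[K]_2 :=
  map_mx (fun p : {poly F} => (map_poly (fun a => tofrac a%:P) p).[tvar^-1]) g.

Definition Gr0_orbit (m : nat) : set 'M[{poly F}]_2 :=
  [set g | Gtinv1 g /\ Gr_orbit m (cosetGt (at_tinv g))].

Definition iota_inv (g : 'M[{poly F}]_2) : 'M[{poly F}]_2 :=
  invmx (map_mx (fun p => p \Po (- 'X)) g).

Definition Gr0_orbit_fixed (m : nat) : set 'M[{poly F}]_2 :=
  [set g | Gr0_orbit m g /\ iota_inv g = g].

(* The coordinates on G[t^-1]_1: coefficients of t^-k in the (i,j) entry *)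
Definition loop_coord (kij : nat * ('I_2 * 'I_2)) (g : 'M[{poly F}]_2) : F :=
  (g kij.2.1 kij.2.2)`_kij.1.

End AffineGrassmannian.

Section SymplecticLieAlgebra.
Variable F : fieldType.

Definition mx_coord n (ij : 'I_n * 'I_n) (A : 'M[F]_n) : F := A ij.1 ij.2.

Definition mx_lie n (A B : 'M[F]_n) : 'M[F]_n := A *m B - B *m A.

Definition symp_form (m : nat) : 'M[F]_(m + m) :=
  block_mx 0 1%:M (- 1%:M) 0.

Definition sp (m : nat) : set 'M[F]_(m + m) :=
  [set A | A^T *m symp_form m + symp_form m *m A = 0].

Arguments sp : clear implicits.

Definition jordan_block n : 'M[F]_n :=
  \matrix_(i < n, j < n) (i.+1 == j :> nat)%:R.

(* Similarity to these Jordan matrices includes nilpotency. *)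
Definition jordan_type_2m (m : nat) (A : 'M[F]_(m + m)) : Prop :=
  A ~_{in unitmx} jordan_block (m + m).

Definition jordan_type_mm (m : nat) (A : 'M[F]_(m + m)) : Prop :=
  A ~_{in unitmx} block_mx (jordan_block m) 0 0 (jordan_block m).

Definition sp_regular_nilpotent_orbit (m : nat) : set 'M[F]_(m + m) :=
  [set A | sp m A /\ jordan_type_2m A].

Definition sp_sl2_triple (m : nat) (x h y : 'M[F]_(m + m)) : Prop :=
  [/\ sp m x, sp m h & sp m y] /\
  [/\ mx_lie h x = x *+ 2, mx_lie h y = - (y *+ 2) & mx_lie x y = h].

(* The Slodowy slice at x, provided (x,h,y) is an sl2-triple in sp(2m) *)
Definition sp_slodowy_slice (m : nat) (x y : 'M[F]_(m + m)) :
    set 'M[F]_(m + m) :=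
  [set x + z | z in [set z | sp m z /\ mx_lie y z = 0]].

End SymplecticLieAlgebra.

Arguments sp : clear implicits.
Arguments sp_regular_nilpotent_orbit : clear implicits.
Arguments Gr0_orbit_fixed : clear implicits.

(* Main.v *)
Require Import Defs.
From mathcomp Require Import all_boot all_order all_algebra.
From mathcomp Require Import fraction mpoly.
From mathcomp Require Import classical_sets reals complex.
From mathcomp Require Import ring zify.

(** Writing s = t^-1, elementary divisors over C[t] show that [g] lies in the
    orbit of t^{m alpha} iff its entries have degree at most m in s, with a
    nonzero coefficient of s^m, and invariance under iota says that the
    coefficients G_j satisfy S G_j = (-1)^j G_j^T S for the standard 2x2 skew
    form S.  For m even, G_m is then scalar with vanishing determinant.

    For m odd, let E be a basis of ker y, on which h acts by -(m-1), and let Phi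
    be the row dual to E under the symplectic form.  To M in the slice one
    attaches g = sum_j (Phi M^(m-1+j) E) s^j, the resolvent t^m Phi (t-M)^-1 E.
    The columns M^i E, i < m, form a basis, so
    M^m E = sum_i M^i E B_i, which says g (1 - sum_i B_i s^(m-i)) = 1: this is
    det g = 1, and conversely such a relation makes the moments Phi M^k E vanish
    for k >= 2m, hence M nilpotent.  Along x + ker (ad y), graded by the weights
    of h, the moments depend triangularly on the coordinates with positive
    diagonal coefficients, so that M can be recovered from g polynomially; the
    symmetry of g forces M to be symplectic by uniqueness. *)

Set Implicit Arguments.
Unset Strict Implicit.
Unset Printing Implicit Defensive.
Import Order.TTheory GRing.Theory Num.Theory.
Local Open Scope classical_set_scope.
Local Open Scope ring_scope.

(** * Krylov bases *)

Section MatrixPowers.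
Variables (R : pzRingType) (n : nat).
Implicit Type A : 'M[R]_n.

Lemma expmxS A k : A ^+ k.+1 = A *m A ^+ k.
Proof. exact: exprS. Qed.

Lemma expmxSr A k : A ^+ k.+1 = A ^+ k *m A.
Proof. exact: exprSr. Qed.

Lemma expmxD A j k : A ^+ (j + k) = A ^+ j *m A ^+ k.
Proof. exact: exprD. Qed.

Lemma expmx0_ge A j k : (j <= k)%N -> A ^+ j = 0 -> A ^+ k = 0.
Proof. by move=> /subnKC <- A0; rewrite expmxD A0 mul0mx. Qed.

End MatrixPowers.

(** Serves to split the columns of [krylov] into m blocks of two: the index l stands for position
    [l %% 2] of block [l %/ 2]. *)
Lemma big_double (V : nmodType) (m : nat) (f : nat -> nat -> V) :
  \sum_(l < m + m) f (l %/ 2)%N (l %% 2)%N =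
  \sum_(b < m) \sum_(c < 2) f b c.
Proof.
rewrite -(big_mkord xpredT (fun l => f (l %/ 2)%N (l %% 2)%N)).
rewrite -(big_mkord xpredT (fun b => \sum_(c < 2) f b c)).
elim: m => [|m IHm]; first by rewrite !big_geq.
rewrite addSn addnS !big_nat_recr //= -IHm -addrA; congr (_ + _).
rewrite !big_ord_recl big_ord0 addr0 /=.
by congr (f _ _ + f _ _); rewrite ?/bump /=; lia.
Qed.

Section Krylov.
Variables (F : fieldType) (m : nat).
Variables (Phi : 'M[F]_(2, m + m)) (E : 'M[F]_(m + m, 2)).

Definition moment (M : 'M[F]_(m + m)) k : 'M[F]_2 := Phi *m M ^+ k *m E.

Definition krylov (M : 'M[F]_(m + m)) : 'M[F]_(m + m) :=
  \matrix_(i, l) (M ^+ (l %/ 2) *m E) i (inord (l %% 2)).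

(** The exponents decrease with k so that, under the hypotheses on moments below,
    [cokrylov M *m krylov M] is upper triangular with ones on the diagonal. *)
Definition cokrylov (M : 'M[F]_(m + m)) : 'M[F]_(m + m) :=
  \matrix_(k, j) (Phi *m M ^+ (m.-1 - k %/ 2)) (inord (k %% 2)) j.

Variable M : 'M[F]_(m + m).
Hypothesis moment_lt : forall k, (k < m.-1)%N -> moment M k = 0.
Hypothesis moment_eq : moment M m.-1 = 1%:M.

Lemma cokrylov_krylovE k l :
  (cokrylov M *m krylov M) k l =
  moment M (m.-1 - k %/ 2 + l %/ 2) (inord (k %% 2)) (inord (l %% 2)).
Proof.
rewrite /moment expmxD mulmxA -mulmxA !mxE.
by apply: eq_bigr => i _; rewrite !mxE.
Qed.

Lemma cokrylov_krylov_unit : cokrylov M *m krylov M \in unitmx.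
Proof.
rewrite unitmxE -det_tr det_trig.
  rewrite (eq_bigr (fun=> 1)) ?big1_eq ?unitr1 // => k _.
  rewrite mxE cokrylov_krylovE subnK ?moment_eq ?mxE ?eqxx //.
  by have := ltn_ord k; lia.
apply/is_trig_mxP => l k lk; rewrite mxE cokrylov_krylovE.
have lt_k := ltn_ord k.
have [eq2|ne2] := eqVneq (k %/ 2)%N (l %/ 2)%N; last first.
  by rewrite moment_lt ?mxE //; lia.
rewrite eq2 subnK; last by lia.
rewrite moment_eq mxE; case: eqP => // /(congr1 (@nat_of_ord _)).
by rewrite !inordK; lia.
Qed.

Lemma krylov_unit : krylov M \in unitmx.
Proof. by have := cokrylov_krylov_unit; rewrite unitmx_mul => /andP[]. Qed.

Lemma cokrylov_unit : cokrylov M \in unitmx.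
Proof. by have := cokrylov_krylov_unit; rewrite unitmx_mul => /andP[]. Qed.

(** The rows of the [Phi *m M ^+ a], a < m, are those of the invertible matrix [cokrylov M].
    Together with [krylov_cosep], this reduces a matrix identity to its entries between
    [Phi *m M ^+ a] and [M ^+ b *m E]. *)
Lemma krylov_sep n (A : 'M[F]_(m + m, n)) :
  (forall a, (a < m)%N -> Phi *m M ^+ a *m A = 0) -> A = 0.
Proof.
move=> A0; have: cokrylov M *m A = 0.
  apply/matrixP=> k j; rewrite mxE.
  transitivity ((Phi *m M ^+ (m.-1 - k %/ 2) *m A) (inord (k %% 2)) j).
    by rewrite mxE; apply: eq_bigr => i _; rewrite mxE.
  by rewrite A0 ?mxE //; have := ltn_ord k; lia.
by move/(congr1 (mulmx (invmx (cokrylov M)))); rewrite mulKmx ?cokrylov_unit ?mulmx0.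
Qed.

Lemma krylov_cosep n (A : 'M[F]_(n, m + m)) :
  (forall b, (b < m)%N -> A *m (M ^+ b *m E) = 0) -> A = 0.
Proof.
move=> A0; have: A *m krylov M = 0.
  apply/matrixP=> i l; rewrite mxE.
  transitivity ((A *m (M ^+ (l %/ 2) *m E)) i (inord (l %% 2))).
    by rewrite mxE; apply: eq_bigr => j _; rewrite mxE.
  by rewrite A0 ?mxE //; have := ltn_ord l; lia.
by move/(congr1 (mulmxr (invmx (krylov M)))); rewrite /= mulmxK ?krylov_unit ?mul0mx.
Qed.

Lemma krylov_span n (A : 'M[F]_(m + m, n)) :
  exists B : nat -> 'M[F]_(2, n), A = \sum_(i < m) M ^+ i *m E *m B i.
Proof.
case: (posnP m) => [m0|m_gt0].
  by exists (fun=> 0); apply/matrixP=> i; have := ltn_ord i; lia.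
have mm0 : (0 < m + m)%N by lia.
pose C := invmx (krylov M) *m A.
(* [B] must be total in b, hence [insubd]; its default is never reached when b < m and c < 2. *)
exists (fun b => \matrix_(c, j) C (insubd (Ordinal mm0) (b * 2 + c)%N) j).
rewrite -[LHS](mulKVmx krylov_unit) -/C.
apply/matrixP=> i j; rewrite mxE summxE.
pose f b c := (M ^+ b *m E) i (inord c) *
              C (insubd (Ordinal mm0) (b * 2 + c)%N) j.
transitivity (\sum_(l < m + m) f (l %/ 2)%N (l %% 2)%N).
  apply: eq_bigr => l _; rewrite /f -divn_eq; congr (_ * C _ _).
    by rewrite mxE.
  by apply: val_inj; rewrite val_insubd ltn_ord.
rewrite big_double; apply: eq_bigr => b _; rewrite [RHS]mxE.
by apply: eq_bigr => c _; rewrite /f inord_val; congr (_ * _); rewrite [RHS]mxE.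
Qed.

End Krylov.

(** * Moments along the Slodowy slice *)

Section Slice.
Variables (F : numFieldType) (m : nat).
Variables (Phi : 'M[F]_(2, m + m)) (E : 'M[F]_(m + m, 2)).
Variables (x y : 'M[F]_(m + m)).
Hypothesis m_gt0 : (0 < m)%N.
Hypothesis x_nilp : x ^+ m = 0.
Hypothesis moment_x : forall k, moment Phi E x k = (k == m.-1)%:R%:M.
Hypothesis yxE : forall i, (i < m)%N ->
  y *m (x ^+ i *m E) = (i * (m - i))%:R *: (x ^+ i.-1 *m E).

Let xm_ge k : (m <= k)%N -> x ^+ k = 0.
Proof. by move=> le_mk; apply: expmx0_ge x_nilp. Qed.

Let moment_x_lt k : (k < m.-1)%N -> moment Phi E x k = 0.
Proof. by move=> lt_k; rewrite moment_x ltn_eqF // raddf0. Qed.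

Let moment_x_eq : moment Phi E x m.-1 = 1%:M.
Proof. by rewrite moment_x eqxx. Qed.

(** By [moment_x], the blocks [x ^+ i *m E] and [Phi *m x ^+ (m.-1 - i)] are dual bases. *)
Lemma resolution : \sum_(i < m) x ^+ i *m E *m Phi *m x ^+ (m.-1 - i) = 1%:M.
Proof.
apply/eqP; rewrite -subr_eq0; apply/eqP.
apply: (krylov_sep moment_x_lt moment_x_eq) => a lt_am.
have lt_a' : (m.-1 - a < m)%N by lia.
rewrite mulmxBr mulmx1 mulmx_sumr (bigD1 (Ordinal lt_a')) //= big1 ?addr0.
  rewrite !mulmxA -[X in X *m E]mulmxA -expmxD -/(moment _ _ _ _).
  rewrite subnKC; last by lia.
  rewrite moment_x_eq mul1mx; apply/eqP; rewrite subr_eq0; apply/eqP.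
  by congr (_ *m _ ^+ _); lia.
move=> i ne_i; rewrite !mulmxA -[X in X *m E]mulmxA -expmxD -/(moment _ _ _ _).
rewrite moment_x (_ : (_ == _) = false) ?raddf0 ?mul0mx //.
apply: contraNF ne_i => /eqP eq_ai; apply/eqP/val_inj => /=; lia.
Qed.

(* [filt d e z] says that z raises the filtration of the span of the
   [x ^+ i *m E] by at most d - e. *)
Definition filt (d e : nat) (z : 'M[F]_(m + m)) : Prop :=
  forall a b, (a + b + d < m.-1 + e)%N -> Phi *m x ^+ a *m z *m (x ^+ b *m E) = 0.

Lemma filt_weaken d e d' e' z :
  (d + e' <= d' + e)%N -> filt d e z -> filt d' e' z.
Proof. by move=> le_de zde a b lt_ab; apply: zde; lia. Qed.

Lemma filt0 d e : filt d e 0.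
Proof. by move=> a b _; rewrite mulmx0 mul0mx. Qed.

Lemma filtD d e z w : filt d e z -> filt d e w -> filt d e (z + w).
Proof. by move=> zde wde a b lt_ab; rewrite mulmxDr mulmxDl zde ?wde ?addr0. Qed.

(** Insert [resolution] between z and w: in each term the two exponents add up to too little for
    both factors to survive. *)
Lemma filtM d e d' e' z w :
  filt d e z -> filt d' e' w -> filt (d + d') (e + e') (z *m w).
Proof.
move=> zde wde a b lt_ab.
rewrite -[z]mulmx1 -resolution !mulmxA mulmx_sumr !mulmx_suml big1 // => i _.
have lt_im := ltn_ord i.
case: (ltnP (a + i + d) (m.-1 + e)) => lt_z.
  have := zde a i lt_z; rewrite !mulmxA => ->; by rewrite !mul0mx.
have lt_w : (m.-1 - i + b + d' < m.-1 + e')%N by lia.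
have := wde _ b lt_w; rewrite !mulmxA => w0.
by rewrite -!mulmxA; rewrite -!mulmxA in w0; rewrite w0 !mulmx0.
Qed.

Lemma filt_expmx n : filt n 0 (x ^+ n).
Proof.
move=> a b lt_ab; rewrite mulmxA -!(mulmxA Phi (x ^+ _) (x ^+ _)) -!expmxD.
rewrite -!(mulmxA Phi (x ^+ _) (x ^+ _)) -!expmxD; apply: moment_x_lt; lia.
Qed.

Lemma filt_x : filt 1 0 x.
Proof. by rewrite -[X in filt _ _ X]expr1; apply: filt_expmx. Qed.

(** All a, b < m satisfy a + b < m.-1 + m, so every entry of z in the Krylov bases vanishes. *)
Lemma filt_eq0 z : filt 0 m z -> z = 0.
Proof.
move=> z0; apply: (krylov_sep moment_x_lt moment_x_eq) => a lt_am.
apply: (krylov_cosep moment_x_lt moment_x_eq) => b lt_bm.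
by apply: z0; lia.
Qed.

(** The coefficients of the lowering operator y in the irreducible sl2-representation of dimension
    m. *)
Definition sl2_coef i : F := (i * (m - i))%:R.

Lemma sl2_coef_gt0 i : (0 < i < m)%N -> 0 < sl2_coef i.
Proof. by move=> lt_i; rewrite /sl2_coef ltr0n muln_gt0; lia. Qed.

(** Paired with [x ^+ i *m E], both sides vanish unless a + i = m, and then the coefficients agree
    because [sl2_coef] is symmetric under i -> m - i. *)
Lemma Phixy a : (a < m)%N ->
  Phi *m x ^+ a *m y = sl2_coef a *: (Phi *m x ^+ a.-1).
Proof.
move=> lt_am; apply/eqP; rewrite -subr_eq0; apply/eqP.
apply: (krylov_cosep moment_x_lt moment_x_eq) => i lt_im.
rewrite mulmxBl -(mulmxA _ y) yxE // -scalemxAr -scalemxAl !mulmxA.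
rewrite -!(mulmxA Phi (x ^+ _) (x ^+ _)) -!expmxD -!/(moment _ _ _ _).
rewrite !moment_x /sl2_coef.
case: a lt_am => [|a] lt_am; case: i lt_im => [|i] lt_im.
- by rewrite !mul0n !scale0r subrr.
- rewrite mul0n scale0r subr0 add0n (_ : (_ == _) = false) ?raddf0 ?scaler0 //.
  by apply/eqP => /=; lia.
- rewrite mul0n scale0r sub0r (_ : (_ == _) = false) ?raddf0 ?scaler0 ?oppr0 //.
  by apply/eqP => /=; lia.
- rewrite /= addnS addSn; case: eqP => eq_ai; last first.
    by rewrite raddf0 !scaler0 subrr.
  have -> : i = (m.-2 - a)%N by lia.
  have -> : ((m.-2 - a).+1 * (m - (m.-2 - a).+1) = a.+1 * (m - a.+1))%N.
    by rewrite mulnC; congr (_ * _)%N; lia.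
  by rewrite subrr.
Qed.

Definition ycoef a j : F := \prod_(i < j) sl2_coef (a - i).

Lemma ycoef_gt0 a j : (j <= a < m)%N -> 0 < ycoef a j.
Proof.
move=> le_ja; apply: prodr_gt0 => i _; apply: sl2_coef_gt0.
by have := ltn_ord i; lia.
Qed.

Lemma Phixyj a j : (a < m)%N ->
  Phi *m x ^+ a *m y ^+ j =
  if (j <= a)%N then ycoef a j *: (Phi *m x ^+ (a - j)) else 0.
Proof.
move=> lt_am; elim: j => [|j IHj].
  by rewrite /ycoef big_ord0 scale1r mulmx1 subn0.
rewrite expmxSr mulmxA IHj.
case: (leqP j a) => [le_ja|lt_aj]; last first.
  by rewrite mul0mx ifN // -ltnNge ltnW.
rewrite -scalemxAl Phixy ?scalerA; last by lia.
case: ltnP => [lt_ja|le_aj].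
  by rewrite /ycoef big_ord_recr /= subnS.
have -> : j = a by lia.
by rewrite subnn /sl2_coef mul0n mulr0 scale0r.
Qed.

Lemma yjxE j : (j < m)%N ->
  y ^+ j *m (x ^+ m.-1 *m E) = ycoef m.-1 j *: (x ^+ (m.-1 - j) *m E).
Proof.
elim: j => [|j IHj] lt_jm.
  by rewrite /ycoef big_ord0 scale1r mul1mx subn0.
rewrite expmxS -mulmxA IHj; last by lia.
rewrite -scalemxAr yxE; last by lia.
by rewrite scalerA /ycoef [in RHS]big_ord_recr /= subnS.
Qed.

(** * Matrices commuting with y *)

Section Centralizer.
Variable z : 'M[F]_(m + m).
Hypothesis comm_yz : y *m z = z *m y.

(** A matrix commuting with y is determined by its value on the highest weight vectors
    [x ^+ m.-1 *m E]; this is the component of that value along [x ^+ (m.-1 - k) *m E]. *)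
Definition slice_coord k : 'M[F]_2 := Phi *m x ^+ k *m z *m (x ^+ m.-1 *m E).

Definition slice_ratio a b : F :=
  if [&& a < m, b < m & m.-1 <= a + b]%N
  then ycoef a (m.-1 - b) / ycoef m.-1 (m.-1 - b) else 0.

Lemma comm_expy j : y ^+ j *m z = z *m y ^+ j.
Proof.
elim: j => [|j IHj]; first by rewrite mul1mx mulmx1.
by rewrite expmxS -mulmxA IHj !mulmxA comm_yz.
Qed.

(** Up to a nonzero factor, [x ^+ b *m E] is [y ^+ (m.-1 - b)] applied to the highest weight
    vectors. This power of y moves through z and acts on [Phi *m x ^+ a] by [Phixyj]. If a + b <
    m.-1 the result is 0, so the truncated subtraction on the right does no harm. *)
Lemma slice_entryE a b :
  Phi *m x ^+ a *m z *m (x ^+ b *m E) =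
  slice_ratio a b *: slice_coord (a + b - m.-1).
Proof.
rewrite /slice_ratio.
case: ltnP => [lt_am|le_ma] /=; last by rewrite (xm_ge le_ma) mulmx0 !mul0mx scale0r.
case: ltnP => [lt_bm|le_mb] /=; last by rewrite (xm_ge le_mb) mul0mx mulmx0 scale0r.
have c_neq0 : ycoef m.-1 (m.-1 - b) != 0 by rewrite gt_eqF // ycoef_gt0 //; lia.
apply: (scalerI c_neq0).
rewrite scalemxAr.
have lt_j : (m.-1 - b < m)%N by lia.
have := yjxE lt_j; rewrite subKn; last by lia.
move=> <-; rewrite (mulmxA _ (y ^+ _)) -(mulmxA _ z) -comm_expy (mulmxA (Phi *m _)) Phixyj //.
case: leqP => [le_ba|lt_ab].
  have -> : (m.-1 <= a + b)%N by lia.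
  rewrite scalerA mulrCA divff // mulr1 -!scalemxAl /slice_coord.
  by congr (_ *: (_ *m _ ^+ _ *m _ *m _)); lia.
rewrite (_ : (m.-1 <= a + b)%N = false); last by lia.
by rewrite scale0r scaler0 !mul0mx.
Qed.

Lemma slice_ratio_ge0 a b : 0 <= slice_ratio a b.
Proof.
rewrite /slice_ratio; case: ifP => // /and3P[lt_am lt_bm le_ab].
by rewrite divr_ge0 // ltW // ycoef_gt0 //; lia.
Qed.

Lemma slice_filt k :
  (forall a, (a < k)%N -> slice_coord a = 0) -> filt 0 k z.
Proof.
move=> coord0 a b lt_ab; rewrite slice_entryE.
case: (leqP m.-1 (a + b)) => le_ab; first by rewrite coord0 ?scaler0 //; lia.
rewrite /slice_ratio (_ : [&& _, _ & _] = false) ?scale0r //.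
by apply/negP => /and3P[]; lia.
Qed.

Definition slice_weight k : F :=
  \sum_(p < m + k) slice_ratio p (m + k - p.+1).

(** No cancellation can occur: all ratios are nonnegative, and the term p = k is positive. *)
Lemma slice_weight_gt0 k : (k < m)%N -> 0 < slice_weight k.
Proof.
move=> lt_km; have lt_k : (k < m + k)%N by lia.
rewrite /slice_weight (bigD1 (Ordinal lt_k)) //= ltr_pwDl //.
  rewrite /slice_ratio ifT; last by apply/and3P; split; lia.
  by rewrite divr_gt0 // ycoef_gt0 //; lia.
by apply: sumr_ge0 => p _; apply: slice_ratio_ge0.
Qed.

Lemma slice_weightE k :
  \sum_(p < m + k) Phi *m (x ^+ p *m z *m x ^+ (m + k - p.+1)) *m E =
  slice_weight k *: slice_coord k.
Proof.
rewrite scaler_suml; apply: eq_bigr => p _.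
rewrite !mulmxA -(mulmxA _ _ E) slice_entryE; congr (_ *: slice_coord _).
by have := ltn_ord p; lia.
Qed.

End Centralizer.

(** Each factor x replaced by z costs one degree in the filtration. *)
Lemma expmx_perturb0 z n : filt 0 0 z -> filt n 1 ((x + z) ^+ n - x ^+ n).
Proof.
move=> z0; elim: n => [|n IHn]; first by rewrite subrr; apply: filt0.
have -> : (x + z) ^+ n.+1 - x ^+ n.+1 =
   x *m ((x + z) ^+ n - x ^+ n) + z *m ((x + z) ^+ n - x ^+ n) + z *m x ^+ n.
  by rewrite !expmxS mulmxDl !mulmxBr -[RHS]addrA subrK addrAC.
apply: filtD.
  by rewrite -mulmxDl; apply: (@filtM 1 0 n 1) => //; apply: filtD;
     [exact: (@filt_x) | apply: filt_weaken z0].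
by apply: (@filt_weaken (0 + n)%N (0 + 0)%N); [lia | apply: (filtM z0 (@filt_expmx n))].
Qed.

(** First-order expansion in w. In the linear term, replacing [x + z] by x costs one further degree,
    and so do the terms of higher order in w. The two bounds are proved together since the second
    needs the first. *)
Lemma expmx_perturb z w k n : filt 0 0 z -> filt 0 k w ->
  filt n k.+1 ((x + z + w) ^+ n - (x + z) ^+ n) /\
  filt n k.+2 ((x + z + w) ^+ n - (x + z) ^+ n -
               \sum_(p < n) x ^+ p *m w *m x ^+ (n - p.+1)).
Proof.
move=> z0 wk; elim: n => [|n [IH1 IH2]].
  by rewrite subrr big_ord0 subrr; split; apply: filt0.
have w0 : filt 0 0 w by apply: filt_weaken wk.
have xz1 : filt 1 0 (x + z).
  by apply: filtD; [exact: (@filt_x) | apply: filt_weaken z0].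
set M := x + z in IH1 IH2 xz1 *.
have Mw1 : filt n 1 ((M + w) ^+ n - x ^+ n).
  by rewrite /M -addrA; apply: expmx_perturb0; apply: filtD.
set D := (M + w) ^+ n - M ^+ n in IH1 IH2 *.
have eqD : (M + w) ^+ n.+1 - M ^+ n.+1 = M *m D + w *m (M + w) ^+ n.
  by rewrite /D !expmxS mulmxDl mulmxBr addrAC.
have eqS : \sum_(p < n.+1) x ^+ p *m w *m x ^+ (n.+1 - p.+1) =
    w *m x ^+ n + x *m \sum_(p < n) x ^+ p *m w *m x ^+ (n - p.+1).
  rewrite big_ord_recl /= mul1mx subSS subn0 mulmx_sumr; congr (_ + _).
  by apply: eq_bigr => p _; rewrite /bump /= expmxS subSS !mulmxA.
split.
  rewrite eqD; apply: filtD.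
    by apply: (@filt_weaken (1 + n)%N (0 + k.+1)%N); [lia | apply: filtM].
  rewrite -[(M + w) ^+ n](subrK (x ^+ n)) mulmxDr; apply: filtD.
    by apply: (@filt_weaken (0 + n)%N (k + 1)%N); [lia | apply: filtM].
  apply: (@filt_weaken (0 + n)%N (k + 0)%N); first lia.
  exact: (filtM wk (@filt_expmx n)).
rewrite eqD eqS.
set S := \sum_(p < n) _ in IH2 *.
have -> : M *m D + w *m (M + w) ^+ n - (w *m x ^+ n + x *m S) =
   x *m (D - S) + z *m D + w *m ((M + w) ^+ n - x ^+ n).
  rewrite {1}/M mulmxDl !mulmxBr opprD [- _ - _]addrC addrACA.
  by congr (_ + _); rewrite addrAC.
apply: filtD; first apply: filtD.
- exact: (filtM (@filt_x) IH2).
- by apply: (@filt_weaken (0 + n)%N (0 + k.+1)%N); [lia | apply: filtM].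
- by apply: (@filt_weaken (0 + n)%N (k + 1)%N); [lia | apply: filtM].
Qed.

Lemma filt_moment d e z : (d < m.-1 + e)%N -> filt d e z -> Phi *m z *m E = 0.
Proof. by move=> lt_de /(_ 0 0)%N; rewrite mulmx1 mul1mx; apply. Qed.

Lemma moment_low z n : filt 0 0 z -> (n < m)%N ->
  moment Phi E (x + z) n = moment Phi E x n.
Proof.
move=> z0 lt_nm; apply/eqP; rewrite -subr_eq0 -mulmxBl -mulmxBr; apply/eqP.
by apply: (@filt_moment n 1); [lia | apply: expmx_perturb0].
Qed.

Lemma moment_stable z w k n : filt 0 0 z -> filt 0 k w -> (n < m + k)%N ->
  moment Phi E (x + z + w) n = moment Phi E (x + z) n.
Proof.
move=> z0 wk lt_n; apply/eqP; rewrite -subr_eq0 -mulmxBl -mulmxBr; apply/eqP.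
have [wk1 _] := expmx_perturb n z0 wk.
by apply: filt_moment wk1; lia.
Qed.

(** The triangularity of moments: at order m + k the remainder in [expmx_perturb] is just low enough
    for [filt_moment], and the linear term is given by [slice_weightE]. *)
Lemma moment_perturb z w k :
    filt 0 0 z -> y *m w = w *m y -> filt 0 k w ->
  moment Phi E (x + z + w) (m + k) =
  moment Phi E (x + z) (m + k) + slice_weight k *: slice_coord w k.
Proof.
move=> z0 comm_w wk; apply/eqP; rewrite -subr_eq0 opprD addrA; apply/eqP.
have [_ wk2] := expmx_perturb (m + k) z0 wk.
rewrite -mulmxBl -mulmxBr -slice_weightE // -mulmx_suml -mulmx_sumr.
rewrite -mulmxBl -mulmxBr.
by apply: filt_moment wk2; lia.
Qed.

Lemma comm_filt0 z : y *m z = z *m y -> filt 0 0 z.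
Proof. by move=> comm_z; apply: slice_filt. Qed.

Lemma comm_subl z w :
  y *m z = z *m y -> y *m w = w *m y -> y *m (w - z) = (w - z) *m y.
Proof. by move=> cz cw; rewrite mulmxBr mulmxBl cz cw. Qed.

(** The coordinates of [w - z] vanish one after the other: once those below a do, equality of the
    moments of order m + a kills the coordinate a, because its weight is positive. *)
Lemma slice_moment_inj z w : y *m z = z *m y -> y *m w = w *m y ->
    (forall j, (j < m)%N ->
       moment Phi E (x + z) (m + j) = moment Phi E (x + w) (m + j)) ->
  z = w.
Proof.
move=> cz cw eq_mom; have cd := comm_subl cz cw.
suff: filt 0 m (w - z).
  by move/filt_eq0/eqP; rewrite subr_eq0 => /eqP.
apply: slice_filt => // a.
elim/ltn_ind: a => a IHa lt_am.
have fa : filt 0 a (w - z).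
  by apply: slice_filt => // b lt_ba; apply: IHa => //; lia.
have := moment_perturb (comm_filt0 cz) cd fa.
have -> : x + z + (w - z) = x + w by rewrite addrA addrAC addrK.
rewrite -eq_mom // => /eqP; rewrite -[X in X == _]addr0 (inj_eq (addrI _)).
rewrite eq_sym scaler_eq0 => /orP[|/eqP //].
by rewrite gt_eqF // slice_weight_gt0.
Qed.

(** The inner sum is the operator sending [x ^+ i *m E] to [x ^+ i *m E *m A], that is, A acting on
    the multiplicity space; it commutes with y, and [y ^+ k] places it in degree -k. *)
Definition slice_lift k (A : 'M[F]_2) : 'M[F]_(m + m) :=
  y ^+ k *m \sum_(i < m) x ^+ i *m E *m A *m Phi *m x ^+ (m.-1 - i).

Lemma diag_xE A i : (i < m)%N ->
  (\sum_(i < m) x ^+ i *m E *m A *m Phi *m x ^+ (m.-1 - i)) *m (x ^+ i *m E) =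
  x ^+ i *m E *m A.
Proof.
move=> lt_im; rewrite mulmx_suml (bigD1 (Ordinal lt_im)) //= big1 ?addr0.
  rewrite mulmxA -(mulmxA _ (x ^+ (m.-1 - i))) -expmxD -!(mulmxA _ Phi).
  rewrite -!mulmxA !(mulmxA Phi) -/(moment _ _ _ _) subnK; last by lia.
  by rewrite moment_x_eq mulmx1.
move=> j ne_ji.
rewrite mulmxA -(mulmxA _ (x ^+ (m.-1 - j))) -expmxD.
rewrite -!mulmxA !(mulmxA Phi) -/(moment _ _ _ _) moment_x.
rewrite (_ : (_ == _) = false) ?raddf0 ?mulmx0 //.
apply: contraNF ne_ji => /eqP eq_ji; apply/eqP/val_inj => /=.
by have := ltn_ord j; lia.
Qed.

Lemma slice_lift_comm k A : y *m slice_lift k A = slice_lift k A *m y.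
Proof.
rewrite /slice_lift mulmxA -expmxS expmxSr -!mulmxA; congr (_ *m _).
apply/eqP; rewrite -subr_eq0; apply/eqP.
apply: (krylov_cosep moment_x_lt moment_x_eq) => i lt_im.
rewrite mulmxBl -!mulmxA diag_xE // yxE // !mulmxA -scalemxAr.
rewrite diag_xE; last by lia.
by rewrite -(mulmxA y) yxE // -scalemxAl subrr.
Qed.

Lemma slice_lift_coord k A j : (k < m)%N -> (j <= k)%N ->
  slice_coord (slice_lift k A) j = (j == k)%:R *: (ycoef k k *: A).
Proof.
move=> lt_km le_jk; rewrite /slice_coord /slice_lift -!mulmxA diag_xE; last by lia.
rewrite !mulmxA Phixyj; last by lia.
case: leqP => [le_kj|lt_jk]; last by rewrite ltn_eqF // !mul0mx scale0r.
have -> : j = k by lia.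
rewrite eqxx scale1r subnn mulmx1 -!scalemxAl -!/(moment _ _ _ _).
by rewrite moment_x_eq mul1mx.
Qed.

Lemma slice_lift_filt k A : (k < m)%N -> filt 0 k (slice_lift k A).
Proof.
move=> lt_km; apply: slice_filt; first exact: slice_lift_comm.
by move=> a lt_ak; rewrite slice_lift_coord ?(ltnW lt_ak) // ltn_eqF ?scale0r.
Qed.

(* Correcting the moments of order m, m + 1, ... successively. *)
Fixpoint slice_solve (G : nat -> 'M[F]_2) k : 'M[F]_(m + m) :=
  if k is k'.+1 then
    let M := slice_solve G k' in
    M + slice_lift k' ((slice_weight k' * ycoef k' k')^-1 *:
                       (G k'.+1 - moment Phi E M (m + k')))
  else x.

Lemma slice_solve_comm G k :
  y *m (slice_solve G k - x) = (slice_solve G k - x) *m y.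
Proof.
elim: k => [|k IHk] /=; first by rewrite subrr mulmx0 mul0mx.
by rewrite addrAC mulmxDr mulmxDl IHk slice_lift_comm.
Qed.

(** By [moment_stable] a correction preserves the moments already fixed. The scalar in [slice_solve]
    cancels the weight from [moment_perturb] and the factor [ycoef k k] from [slice_lift_coord]. The
    shift in [G j.+1] reflects that coefficient j of a loop is the moment of order m.-1 + j. *)
Lemma slice_solve_moment G k j : (j < k)%N -> (k <= m)%N ->
  moment Phi E (slice_solve G k) (m + j) = G j.+1.
Proof.
elim: k => // k IHk le_jk le_km /=.
set A := _ *: (G _ - _).
have z0 := comm_filt0 (slice_solve_comm G k).
have wk : filt 0 k (slice_lift k A) by apply: slice_lift_filt.
rewrite -[slice_solve G k](subrKC x).
case: (ltngtP j k) => [lt_jk|lt_kj|eq_jk]; last first.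
- rewrite eq_jk moment_perturb //; last exact: slice_lift_comm.
  rewrite slice_lift_coord // eqxx scale1r !scalerA subrKC mulfV ?scale1r ?subrKC //.
  by rewrite mulf_neq0 // gt_eqF ?slice_weight_gt0 ?ycoef_gt0 ?leqnn.
- by lia.
by rewrite (moment_stable z0 wk) ?ltn_add2l // subrKC; apply: IHk => //; lia.
Qed.

End Slice.

(** * Matrix polynomials and nilpotency *)

Lemma big_ord_trim (V : nmodType) a b (f : nat -> V) :
    (a <= b)%N -> (forall i, (a <= i < b)%N -> f i = 0) ->
  \sum_(i < b) f i = \sum_(i < a) f i.
Proof.
move=> le_ab f0; rewrite -!(big_mkord xpredT) (big_cat_nat (leq0n a) le_ab) /=.
by rewrite [X in _ + X]big_nat [X in _ + X]big1 ?addr0.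
Qed.

Section LoopCoefficients.
Variable F : fieldType.
Implicit Types g h : 'M[{poly F}]_2.

Definition loop_coef j g : 'M[F]_2 := map_mx (fun p : {poly F} => p`_j) g.

Definition loop_of (G : nat -> 'M[F]_2) m : 'M[{poly F}]_2 :=
  \matrix_(i, k) \poly_(j < m.+1) G j i k.

Lemma loop_coef_inj g h : (forall j, loop_coef j g = loop_coef j h) -> g = h.
Proof.
move=> eq_gh; apply/matrixP=> i k; apply/polyP=> j.
by have /matrixP/(_ i k) := eq_gh j; rewrite !mxE.
Qed.

Lemma loop_ofK G m j : (j <= m)%N -> loop_coef j (loop_of G m) = G j.
Proof. by move=> le_jm; apply/matrixP=> i k; rewrite !mxE coef_poly ltnS le_jm. Qed.

Lemma loop_of_gt G m j : (m < j)%N -> loop_coef j (loop_of G m) = 0.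
Proof.
by move=> lt_mj; apply/matrixP=> i k; rewrite !mxE coef_poly ltnS leqNgt lt_mj.
Qed.

Lemma loop_coefM n g h :
  loop_coef n (g *m h) = \sum_(i < n.+1) loop_coef (n - i) g *m loop_coef i h.
Proof.
apply/matrixP=> i k; rewrite !mxE coef_sum summxE.
under eq_bigr do rewrite coefMr.
by rewrite exchange_big; apply: eq_bigr => a _; rewrite mxE;
   apply: eq_bigr => b _; rewrite !mxE.
Qed.

Lemma loop_coef_tr j g : loop_coef j g^T = (loop_coef j g)^T.
Proof. by apply/matrixP=> i k; rewrite !mxE. Qed.

Lemma loop_coef1 j : loop_coef j 1%:M = (j == 0%N)%:R%:M.
Proof.
apply/matrixP=> i k; rewrite !mxE; case: (i == k) => /=; last by rewrite coef0.
by rewrite coef1.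
Qed.

End LoopCoefficients.

(** * Moments as coefficients of a loop of determinant one *)

Section RegularNilpotent.
Variables (F : fieldType) (m : nat).
Variables (Phi : 'M[F]_(2, m + m)) (E : 'M[F]_(m + m, 2)).
Variable M : 'M[F]_(m + m).
Hypothesis m_gt0 : (0 < m)%N.
Hypothesis moment_lt : forall k, (k < m.-1)%N -> moment Phi E M k = 0.
Hypothesis moment_eq : moment Phi E M m.-1 = 1%:M.

Local Notation mom := (moment Phi E M).

(** Turns the coefficient of s^n in a product of loops into a linear recurrence on moments. Low
    moments and high coefficients of [H] vanish, so both sums extend to a common range. *)
Lemma moment_conv (H : nat -> 'M[F]_2) n :
    (forall i, (m < i)%N -> H i = 0) -> (0 < n)%N ->
  \sum_(i < n.+1) mom (m.-1 + (n - i)) *m H i =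
  mom (m.-1 + n) *m H 0%N + \sum_(i < m) mom (n.-1 + i) *m H (m - i)%N.
Proof.
move=> H0 n_gt0; pose f i := mom (m.-1 + n - i) *m H i.
transitivity (\sum_(i < n.+1) f i).
  by apply: eq_bigr => i _; rewrite /f addnBA // -ltnS.
rewrite -(@big_ord_trim _ n.+1 (maxn n m).+1 f); first last.
- by move=> i lt_i; rewrite /f moment_lt ?mul0mx //; lia.
- by lia.
rewrite (@big_ord_trim _ m.+1 (maxn n m).+1 f); first last.
- by move=> i lt_i; rewrite /f H0 ?mulmx0 //; lia.
- by lia.
rewrite big_ord_recl {1}/f subn0; congr (_ + _).
rewrite (reindex_inj rev_ord_inj); apply: eq_bigr => i _.
have lt_i := ltn_ord i; rewrite /f /= /bump /=.
by congr (mom _ *m H _); lia.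
Qed.

Lemma krylov_eq0 (A : 'M[F]_(m + m)) :
    (forall a b, (a < m)%N -> (b < m)%N ->
       Phi *m M ^+ a *m A *m (M ^+ b *m E) = 0) -> A = 0.
Proof.
move=> A0; apply: (krylov_sep moment_lt moment_eq) => a lt_am.
by apply: (krylov_cosep moment_lt moment_eq) => b lt_bm; apply: A0.
Qed.

Lemma moment_sandwich a k b :
  Phi *m M ^+ a *m M ^+ k *m (M ^+ b *m E) = mom (a + k + b).
Proof. by rewrite /moment !expmxD !mulmxA. Qed.

(** Between Krylov vectors, the only entry of [M ^+ (m + m).-1] not already killed by nilpotency is
    the one with a = b = 0, which is this moment. *)
Lemma regular_nilpotent_moment :
  M ^+ (m + m) = 0 -> M ^+ (m + m).-1 != 0 -> mom (m + m).-1 != 0.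
Proof.
move=> M0; apply: contra_neq => mom0; apply: krylov_eq0 => a b lt_am lt_bm.
rewrite moment_sandwich; case: (posnP (a + b)) => ab.
  by rewrite (_ : (_ + _)%N = (m + m).-1) //; lia.
by rewrite /moment (expmx0_ge _ M0) ?mulmx0 ?mul0mx //; lia.
Qed.

(** The loop has a polynomial inverse, so its determinant is a unit of F[s], hence a constant, and
    its value at s = 0 is [\det (mom m.-1)], which is 1. *)
Lemma regular_nilpotent_det :
  M ^+ (m + m) = 0 -> \det (loop_of (fun j => mom (m.-1 + j)) m) = 1.
Proof.
move=> M0; set g := loop_of _ m.
have gE j : loop_coef j g = mom (m.-1 + j).
  case: (leqP j m) => [|lt_mj]; first exact: loop_ofK.
  rewrite /g loop_of_gt // /moment (expmx0_ge _ M0) ?mulmx0 ?mul0mx //; lia.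
have [B MmE] := krylov_span moment_lt moment_eq (M ^+ m *m E).
(* The coefficients of the inverse, read off from the expression of [M ^+ m *m E] in the Krylov
   basis. *)
pose H j := if j is 0 then 1%:M else - B (m - j)%N.
have gh1 : g *m loop_of H m = 1%:M.
  apply: loop_coef_inj => n; rewrite loop_coefM loop_coef1.
  case: (posnP n) => [->|n_gt0].
    by rewrite big_ord1 gE addn0 loop_ofK // moment_eq mulmx1.
  under eq_bigr do rewrite gE.
  rewrite (moment_conv (H := fun j => loop_coef j (loop_of H m))) //; last first.
    by move=> i lt_mi; rewrite loop_of_gt.
  rewrite loop_ofK // mulmx1.
  have -> : (m.-1 + n = n.-1 + m)%N by lia.
  rewrite /moment expmxD mulmxA -(mulmxA _ (M ^+ m)) MmE mulmx_sumr raddf0.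
  rewrite -big_split big1 //= => i _; have lt_i := ltn_ord i.
  rewrite loop_ofK ?leq_subr // (_ : (m - i)%N = (m - i).-1.+1) /=; last by lia.
  rewrite mulmxN expmxD !mulmxA (_ : (m - (m - i).-1.+1)%N = i) ?subrr //; lia.
have: \det g * \det (loop_of H m) = 1 by rewrite -det_mulmx gh1 det1.
move=> det_gh; have: \det g \is a GRing.unit.
  by apply/unitrPr; exists (\det (loop_of H m)).
rewrite poly_unitE => /andP[/size_poly1P[c _ det_c] _].
have: (\det g).[0] = 1.
  rewrite -[LHS]/(horner_eval 0 (\det g)) -det_map_mx.
  rewrite (_ : map_mx _ g = 1%:M) ?det1 //.
  rewrite -moment_eq -[in RHS](addn0 m.-1) -gE.
  by apply/matrixP=> i k; rewrite !mxE /horner_eval /= -horner_coef0.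
by rewrite det_c hornerC => ->.
Qed.

Section Inverse.
Variables g h : 'M[{poly F}]_2.
Hypothesis gh1 : g *m h = 1%:M.
Hypothesis h0 : loop_coef 0 h = 1%:M.
Hypothesis h_gt : forall j, (m < j)%N -> loop_coef j h = 0.
Hypothesis g_moment : forall j, (j <= m)%N -> loop_coef j g = mom (m.-1 + j).

(** Paired with [Phi *m M ^+ a], the relation is the coefficient a.+1 of [g *m h = 1%:M]. Since a <
    m, only the known moments enter. *)
Lemma krylov_inverse :
  M ^+ m *m E = - \sum_(i < m) M ^+ i *m E *m loop_coef (m - i) h.
Proof.
apply/eqP; rewrite -subr_eq0 opprK; apply/eqP.
apply: (krylov_sep moment_lt moment_eq) => a lt_am.
have: loop_coef a.+1 (g *m h) = 0 by rewrite gh1 loop_coef1 raddf0.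
rewrite loop_coefM.
rewrite (eq_bigr (fun i : 'I__ => mom (m.-1 + (a.+1 - i)) *m loop_coef i h)).
  rewrite (moment_conv (H := fun j => loop_coef j h)) // h0 mulmx1 => <-.
  rewrite mulmxDr mulmx_sumr mulmxA -(mulmxA Phi) -expmxD; congr (_ + _).
    by congr (_ *m _ ^+ _ *m _); lia.
  by apply: eq_bigr => i _; rewrite /moment /= expmxD !mulmxA.
by move=> i _; rewrite g_moment //; lia.
Qed.

(** Beyond m, the moments and the coefficients of g obey the same recurrence, with coefficients from
    h: the former by [krylov_inverse], the latter by [gh1]. As [h0] makes the leading term explicit,
    agreement propagates to all orders. *)
Lemma moment_inverse j : mom (m.-1 + j) = loop_coef j g.
Proof.
elim/ltn_ind: j => j IHj.
case: (leqP j m) => [le_jm|lt_mj]; first by rewrite g_moment.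
have j_gt0 : (0 < j)%N by lia.
have: loop_coef j (g *m h) = 0.
  by rewrite gh1 loop_coef1 (_ : j == 0%N = false) ?raddf0 //; lia.
have: \sum_(i < j.+1) mom (m.-1 + (j - i)) *m loop_coef i h = 0.
  rewrite (moment_conv (H := fun j => loop_coef j h)) // h0 mulmx1.
  have -> : (m.-1 + j = j.-1 + m)%N by lia.
  rewrite /moment expmxD mulmxA -(mulmxA _ (M ^+ m)) krylov_inverse.
  rewrite mulmxN mulmx_sumr addrC -sumrB big1 // => i _.
  by rewrite expmxD !mulmxA subrr.
rewrite loop_coefM !big_ord_recl /= subn0 h0 !mulmx1.
rewrite (eq_bigr (fun i : 'I__ => loop_coef (j - bump 0 i) g *m
                                   loop_coef (bump 0 i) h)).
  by move=> /eqP; rewrite addr_eq0 => /eqP -> /eqP; rewrite addr_eq0 => /eqP ->.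
by move=> i _; rewrite IHj // /bump /=; lia.
Qed.

End Inverse.
End RegularNilpotent.

(** * The orbits in the affine Grassmannian *)

Section TwoByTwo.
Variable R : comPzRingType.
Implicit Types A B : 'M[R]_2.

Definition mx2 (a b c d : R) : 'M[R]_2 :=
  \matrix_(i, j) if i == 0 then (if j == 0 then a else b)
                 else (if j == 0 then c else d).

Lemma mx2P A B : A 0 0 = B 0 0 -> A 0 1 = B 0 1 -> A 1 0 = B 1 0 ->
  A 1 1 = B 1 1 -> A = B.
Proof.
move=> e00 e01 e10 e11; apply/matrixP=> i j.
have ord2 (k : 'I_2) : k = 0 \/ k = 1.
  by case: k => [[|[|]]] // lt_k; [left | right]; apply: val_inj.
by case: (ord2 i) (ord2 j) => [] -> [] ->.
Qed.

Lemma mulmx2E n p (A : 'M[R]_(n, 2)) (B : 'M[R]_(2, p)) i j :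
  (A *m B) i j = A i 0 * B 0 j + A i 1 * B 1 j.
Proof.
rewrite mxE !big_ord_recl big_ord0 addr0.
by congr (_ + A i _ * B _ j); apply: val_inj.
Qed.

Lemma det_mx2 A : \det A = A 0 0 * A 1 1 - A 0 1 * A 1 0.
Proof.
have lift01 : lift 0 (0 : 'I_1) = 1 :> 'I_2 by apply: val_inj.
have lift10 : lift 1 (0 : 'I_1) = 0 :> 'I_2 by apply: val_inj.
rewrite (expand_det_row _ 0) !big_ord_recl big_ord0 addr0 lift01 /cofactor.
rewrite !det_mx11 !mxE /= !lift01 !lift10 expr0 expr1.
by rewrite !mul1r mulN1r mulrN.
Qed.

End TwoByTwo.

(** * Elementary divisors over F[t] and orbits *)

Section CartanDecomposition.
Variable F : fieldType.
Implicit Types (p q : {poly F}) (g : 'M[{poly F}]_2).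

Local Notation K := {fraction {poly F}}.
Local Notation ev :=
  (horner_eval (tvar F)^-1 \o map_poly (@tofrac {poly F} \o polyC)).

(** An entry of the first row that is nonzero at 0 is coprime to ['X^n], which is a combination of
    that row since it is the determinant. The first row is therefore unimodular and completes to a
    matrix of determinant 1. *)
Lemma smith2_row (Q : 'M[{poly F}]_2) n :
    \det Q = 'X^n -> (Q 0 0).[0] != 0 \/ (Q 0 1).[0] != 0 ->
  exists A B, [/\ \det A = 1, \det B = 1 & Q = A *m mx2 'X^n 0 0 1 *m B].
Proof.
rewrite det_mx2 => detQ Q0.
have bezoutX q : q.[0] != 0 -> exists u v, u * q + v * 'X^n = 1.
  move=> q0; have : coprimep q 'X^n by rewrite coprimep_expr // coprimepX.
  by case/Bezout_eq1_coprimepP => -[u v] /= uv; exists u, v.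
have [u [v uv]] : exists u v, u * Q 0 0 + v * Q 0 1 = 1.
  case: Q0 => /bezoutX[u [v uv]].
    by exists (u + v * Q 1 1), (- (v * Q 1 0)); rewrite -uv -detQ; ring.
  by exists (v * Q 1 1), (u - v * Q 1 0); rewrite -uv -detQ; ring.
exists (mx2 0 1 (- 1) (Q 1 0 * u + Q 1 1 * v)).
exists (mx2 v (- u) (Q 0 0) (Q 0 1)).
split; first by rewrite det_mx2 !mxE /=; ring.
  by rewrite det_mx2 !mxE /= -uv; ring.
apply: mx2P; rewrite !mulmx2E !mxE /= -?detQ; try ring.
- by rewrite -{1}[Q 1 0]mulr1 -{1}uv; ring.
- by rewrite -{1}[Q 1 1]mulr1 -{1}uv; ring.
Qed.

Lemma smith2 (Q : 'M[{poly F}]_2) n :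
    \det Q = 'X^n -> map_mx (fun p => p.[0]) Q != 0 ->
  exists A B, [/\ \det A = 1, \det B = 1 & Q = A *m mx2 'X^n 0 0 1 *m B].
Proof.
move=> detQ Q0.
have [r0|] := boolP (((Q 0 0).[0] != 0) || ((Q 0 1).[0] != 0)).
  by apply: smith2_row detQ _; apply/orP.
rewrite negb_or !negbK => /andP[/eqP Q00 /eqP Q01].
(* Exchanges the rows up to sign, by a matrix of determinant 1. *)
pose Q' := mx2 0 1 (- 1) 0 *m Q.
have [||A [B [detA detB Q'E]]] := @smith2_row Q' n.
- by rewrite det_mulmx detQ det_mx2 !mxE /=; ring.
- apply/orP; rewrite !mulmx2E !mxE /= !mul0r !mul1r !add0r -negb_and.
  apply: contra Q0 => /andP[/eqP Q10 /eqP Q11].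
  by apply/eqP/mx2P; rewrite !mxE.
exists (mx2 0 (- 1) 1 0 *m A), B; split=> //.
  by rewrite det_mulmx detA det_mx2 !mxE /=; ring.
rewrite -!mulmxA (mulmxA A) -Q'E.
by apply: mx2P; rewrite !mulmx2E !mxE /=; ring.
Qed.

(** The reversed polynomial t^N p(1/t), for p of degree at most N. *)
Definition revp N p : {poly F} := \poly_(i < N.+1) p`_(N - i).

Lemma evE N p : (size p <= N.+1)%N -> tvar F ^+ N * ev p = tofrac (revp N p).
Proof.
move=> le_p; have t0 : tvar F != 0 by rewrite tofrac_eq0 polyX_eq0.
rewrite /= /horner_eval (@horner_coef_wide _ N.+1); last first.
  exact: leq_trans (size_poly _ _) le_p.
rewrite mulr_sumr /revp poly_def raddf_sum (reindex_inj rev_ord_inj) /=.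
apply: eq_bigr => i _; rewrite coef_map /= subSS.
rewrite -mul_polyC tofracM tofracXn mulrCA; congr (_ * _).
have le_iN : (i <= N)%N by rewrite -ltnS.
rewrite exprVn -{1}(subnKC (leq_subr i N)) exprD mulrAC mulfV ?expf_neq0 // mul1r.
by rewrite -/(tvar F) subKn.
Qed.

Lemma GtP (a : 'M[K]_2) :
  Gt a <-> exists2 B : 'M[{poly F}]_2, \det B = 1 & a = map_mx (@tofrac _) B.
Proof.
split=> [[det_a [B aE]]|[B detB ->]].
  exists B => //; apply/eqP; rewrite -tofrac_eq rmorph1 -det_a aE.
  by rewrite -det_map_mx.
by split; [rewrite det_map_mx detB rmorph1 | exists B].
Qed.

Lemma GtM (a b : 'M[K]_2) : Gt a -> Gt b -> Gt (a *m b).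
Proof.
move=> /GtP[A detA ->] /GtP[B detB ->]; apply/GtP; exists (A *m B).
  by rewrite det_mulmx detA detB mulr1.
by rewrite map_mxM.
Qed.

Lemma GtV (b : 'M[K]_2) : Gt b -> exists2 c, Gt c & b *m c = 1%:M.
Proof.
move=> /GtP[B detB ->]; exists (map_mx (@tofrac _) (\adj B)).
  apply/GtP; exists (\adj B) => //.
  have := congr1 determinant (mul_mx_adj B).
  by rewrite det_mulmx detB mul1r det1.
by rewrite -map_mxM mul_mx_adj detB map_scalar_mx rmorph1.
Qed.

Lemma tvar_neq0 : tvar F != 0.
Proof. by rewrite tofrac_eq0 polyX_eq0. Qed.

Lemma scale_tpow m : tvar F ^+ m *: tpow F m =
  map_mx (@tofrac _) (mx2 'X^(m + m) 0 0 1).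
Proof.
apply: mx2P; rewrite !mxE /= ?mulr0 ?rmorph0 //.
  by rewrite tofracXn exprD.
by rewrite mulfV ?rmorph1 // expf_neq0 // tvar_neq0.
Qed.

Lemma at_tinvE g : at_tinv g = map_mx ev g.
Proof. by []. Qed.

Lemma scale_at_tinv N g : (forall i k, size (g i k) <= N.+1)%N ->
  tvar F ^+ N *: at_tinv g = map_mx (@tofrac _) (map_mx (revp N) g).
Proof.
by move=> le_g; apply/matrixP=> i k; rewrite at_tinvE !mxE evE.
Qed.

Lemma horner0_revp N p : (revp N p).[0] = p`_N.
Proof. by rewrite horner_coef0 coef_poly subn0. Qed.

Lemma coset_at_tinv m g (a : 'M[K]_2) : Gt a ->
  cosetGt (at_tinv g) = cosetGt (a *m tpow F m) ->
  exists A B, [/\ \det A = 1, \det B = 1 &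
    tvar F ^+ m *: at_tinv g =
    map_mx (@tofrac _) (A *m mx2 'X^(m + m) 0 0 1 *m B)].
Proof.
move=> /GtP[A detA aE] eq_coset.
have : cosetGt (at_tinv g) (at_tinv g).
  exists 1%:M; last by rewrite mulmx1.
  by apply/GtP; exists 1%:M; rewrite ?det1 // map_scalar_mx rmorph1.
rewrite eq_coset => -[b /GtP[B detB bE] gE]; exists A, B; split=> //.
by rewrite !map_mxM -scale_tpow -gE -aE -bE -scalemxAr -scalemxAl.
Qed.

Lemma coef_gt_revp m p (q : {poly F}) :
  tvar F ^+ m * ev p = tofrac q -> (size p <= m.+1)%N.
Proof.
move=> pE; apply/leq_sizeP => j lt_mj.
set N := maxn (size p) (m + j).
have := @evE N p (leq_trans (leq_maxl _ _) (leqnSn _)).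
have le_mN : (m <= N)%N by rewrite leq_max leq_addr orbT.
rewrite -{1}(subnK le_mN) exprD -mulrA pE -tofracXn -tofracM => /eqP.
rewrite tofrac_eq => /eqP/(congr1 (fun r : {poly F} => r`_(N - j))).
rewrite coefXnM coef_poly ltnS leq_subr subKn; last first.
  by rewrite leq_max leq_addl orbT.
by rewrite ifT // ltn_sub2l // (leq_trans lt_mj) // leq_max leq_addl orbT.
Qed.

Lemma loop_coef_size m g :
  (forall i k, size (g i k) <= m.+1)%N <->
  (forall j, (m < j)%N -> loop_coef j g = 0).
Proof.
split=> [le_g j lt_mj|g0 i k].
  by apply/matrixP=> i k; rewrite !mxE; apply: (leq_sizeP _ _ (le_g i k)).
by apply/leq_sizeP => j lt_mj; have /matrixP/(_ i k) := g0 j lt_mj; rewrite !mxE.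
Qed.

Lemma loop_coef0E g : map_mx (fun p => p.[0]) g = loop_coef 0 g.
Proof. by apply/matrixP=> i k; rewrite !mxE horner_coef0. Qed.

Lemma Gr0_orbitP m g : Gr0_orbit m g <->
  [/\ \det g = 1, loop_coef 0 g = 1%:M,
      forall j, (m < j)%N -> loop_coef j g = 0 & loop_coef m g != 0].
Proof.
rewrite /Gr0_orbit /Gtinv1 /Gr_orbit /= loop_coef0E.
split=> [[[det_g g0] [a Gta /esym/(coset_at_tinv Gta)[A [B [detA detB gE]]]]]|].
  have le_g i k : (size (g i k) <= m.+1)%N.
    by move/matrixP/(_ i k): gE; rewrite at_tinvE !mxE => /coef_gt_revp.
  split=> //; first exact/loop_coef_size.
  move: gE; rewrite scale_at_tinv // => /matrixP gE.
  have {}gE : map_mx (revp m) g = A *m mx2 'X^(m + m) 0 0 1 *m B.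
    by apply/matrixP=> i k; apply/eqP; rewrite -tofrac_eq;
       have := gE i k; rewrite [LHS]mxE [RHS]mxE => ->.
  have h0M (C D : 'M[{poly F}]_2) :
      map_mx (horner_eval 0) (C *m D) =
      map_mx (horner_eval 0) C *m map_mx (horner_eval 0) D by rewrite map_mxM.
  have unit0 (C : 'M[{poly F}]_2) : \det C = 1 ->
      map_mx (horner_eval 0) C \in unitmx.
    by move=> detC; rewrite unitmxE det_map_mx detC rmorph1 unitr1.
  have /(congr1 (map_mx (horner_eval 0))) := gE; rewrite !h0M.
  rewrite (_ : map_mx (horner_eval 0) (map_mx _ g) = loop_coef m g); last first.
    by apply/matrixP=> i k; rewrite !mxE /horner_eval horner0_revp.
  (* At t = 0 the outer factors remain invertible, so a zero product would make the middle factor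
     zero, yet its last diagonal entry is 1. *)
  move=> ->; apply/eqP => /(congr1 (mulmxr (invmx (map_mx (horner_eval 0) B)))).
  rewrite /= mulmxK ?unit0 // mul0mx.
  move=> /(congr1 (mulmx (invmx (map_mx (horner_eval 0) A)))).
  rewrite mulKmx ?unit0 // mulmx0 => /matrixP/(_ 1 1).
  by rewrite !mxE /= /horner_eval hornerC => /eqP; rewrite oner_eq0.
move=> [det_g g0 /loop_coef_size le_g gm]; split=> //.
(* The reversed matrix is t^m g, of determinant t^(2m), and its value at t = 0 is the top
   coefficient of g: [smith2] applies. *)
have det_rev : \det (map_mx (revp m) g) = 'X^(m + m).
  apply/eqP; rewrite -tofrac_eq -det_map_mx -scale_at_tinv // detZ at_tinvE.
  by rewrite det_map_mx det_g rmorph1 mulr1 tofracXn -exprM addnn muln2.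
have rev0 : map_mx (fun p => p.[0]) (map_mx (revp m) g) != 0.
  rewrite (_ : map_mx _ _ = loop_coef m g) //.
  by apply/matrixP=> i k; rewrite !mxE horner0_revp.
have [A [B [detA detB revE]]] := smith2 det_rev rev0.
have tm0 : tvar F ^+ m != 0 by rewrite expf_neq0 // tvar_neq0.
have gE : at_tinv g = map_mx (@tofrac _) A *m tpow F m *m map_mx (@tofrac _) B.
  apply: (scalerI tm0); rewrite scale_at_tinv // revE !map_mxM -scale_tpow.
  by rewrite -scalemxAr -scalemxAl.
have GtB : Gt (map_mx (@tofrac _) B) by apply/GtP; exists B.
exists (map_mx (@tofrac _) A); first by apply/GtP; exists A.
rewrite gE; apply/seteqP; split=> _ [b Gtb <-].
  have [c Gtc Bc1] := GtV GtB.
  exists (c *m b); first exact: GtM.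
  by rewrite -!mulmxA (mulmxA _ c) Bc1 mul1mx.
by exists (map_mx (@tofrac _) B *m b); [exact: GtM | rewrite !mulmxA].
Qed.

End CartanDecomposition.

(** * Fixed points of the involution *)

Notation S2 := (mx2 0 1 (-1) 0).

Section Involution.

Lemma S2_tr (R : comPzRingType) : (S2 : 'M[R]_2)^T = - S2.
Proof. by apply: mx2P; rewrite !mxE /= ?oppr0 ?opprK. Qed.

Lemma S2_sqr (R : comPzRingType) : (S2 : 'M[R]_2) *m S2 = - 1%:M.
Proof. by apply: mx2P; rewrite !mulmx2E !mxE /=; ring. Qed.

Lemma S2_congr (R : comPzRingType) (A : 'M[R]_2) :
  A^T *m S2 *m A = \det A *: S2.
Proof. by rewrite det_mx2; apply: mx2P; rewrite !mulmx2E !mxE /=; ring. Qed.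

Variable F : fieldType.
Implicit Types (p : {poly F}) (g : 'M[{poly F}]_2).

Lemma coef_compN p j : (p \Po (- 'X))`_j = (-1) ^+ j * p`_j.
Proof.
have coefNXn i : ((- 'X : {poly F}) ^+ i)`_j = (-1) ^+ j * (j == i)%:R.
  rewrite (exprNn 'X) -(signr_odd {poly F} i) -(signr_odd F j) mulr_sign.
  case odd_i: (odd i); rewrite ?coefN coefXn; case: eqP => [->|_];
    by rewrite ?odd_i ?mulN1r ?mul1r ?mulr0 ?oppr0.
rewrite coef_comp_poly; under eq_bigr do rewrite coefNXn.
case: (ltnP j (size p)) => [lt_j|le_j].
  rewrite (bigD1 (Ordinal lt_j)) //= eqxx mulr1 mulrC big1 ?addr0 // => i ne_ij.
  rewrite (_ : (j == i :> nat) = false) ?mulr0 ?mulr0 //.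
  by apply: contraNF ne_ij => /eqP eq_ij; apply/eqP/val_inj.
rewrite nth_default // mulr0 big1 // => i _.
by rewrite gtn_eqF ?mulr0 ?mulr0 // (leq_trans (ltn_ord i)).
Qed.

Lemma loop_coef_S2l j g : loop_coef j (S2 *m g) = S2 *m loop_coef j g.
Proof.
by apply: mx2P; rewrite [LHS]mxE !mulmx2E !mxE /= ?coefD ?mul0r ?mul1r ?mulN1r
  ?coef0 ?coefN.
Qed.

Lemma loop_coef_S2r j g : loop_coef j (g *m S2) = loop_coef j g *m S2.
Proof.
by apply: mx2P; rewrite [LHS]mxE !mulmx2E !mxE /= ?coefD ?mulr0 ?mulr1 ?mulrN1
  ?coef0 ?coefN.
Qed.

(** In determinant 1, [S2_congr] replaces the inverse by a transpose, which makes the condition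
    linear in g; the substitution s -> -s gives the sign of coefficient j. *)
Lemma iota_fixed g : \det g = 1 ->
  iota_inv g = g <->
  (forall j, S2 *m loop_coef j g = (-1) ^+ j *: ((loop_coef j g)^T *m S2)).
Proof.
move=> det_g; rewrite /iota_inv.
set g' := map_mx (fun p => p \Po (- 'X)) g.
have det_g' : \det g' = 1.
  by rewrite -[g']/(map_mx (comp_poly (- 'X)) g) det_map_mx det_g rmorph1.
have unit_g' : g' \in unitmx by rewrite unitmxE det_g' unitr1.
have S2g' : g'^T *m S2 *m g' = S2 by rewrite S2_congr det_g' scale1r.
transitivity (S2 *m g = g'^T *m S2).
  split=> [g'E|S2g].
    by rewrite -[in LHS]S2g' -[g in LHS]g'E -!mulmxA mulmxV // mulmx1.
  apply: (can_inj (mulKmx unit_g')); rewrite mulmxV //.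
  have S2K : - S2 *m S2 = 1%:M :> 'M[{poly F}]_2 by rewrite mulNmx S2_sqr opprK.
  have : S2 *m (g *m g') = S2 *m 1%:M by rewrite mulmxA S2g S2g' mulmx1.
  move=> /(congr1 (mulmx (- S2))); rewrite !(mulmxA (- S2)) S2K !mul1mx.
  by move=> /mulmx1C.
have coefg' j : loop_coef j g'^T = (-1) ^+ j *: (loop_coef j g)^T.
  by apply/matrixP=> i k; rewrite !mxE coef_compN.
split=> [S2g j|coef_g].
  by rewrite -loop_coef_S2l S2g loop_coef_S2r coefg' scalemxAl.
by apply: loop_coef_inj => j; rewrite loop_coef_S2l coef_g loop_coef_S2r coefg' scalemxAl.
Qed.

Lemma Gr0_orbit_fixedP m g : Gr0_orbit_fixed F m g <->
  [/\ \det g = 1, loop_coef 0 g = 1%:M,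
      forall j, (m < j)%N -> loop_coef j g = 0, loop_coef m g != 0 &
      forall j, S2 *m loop_coef j g = (-1) ^+ j *: ((loop_coef j g)^T *m S2)].
Proof.
split=> [[/Gr0_orbitP[det_g g0 g_gt gm] /(iota_fixed det_g) sym_g] //|].
move=> [det_g g0 g_gt gm sym_g].
by split; [apply/Gr0_orbitP | apply/(iota_fixed det_g)].
Qed.

End Involution.

Lemma eq_oppr0 (F : numDomainType) (a : F) : a = - a -> a = 0.
Proof. by move/esym/eqP; rewrite eqNr => /eqP. Qed.

(* The leading coefficient of a fixed point of even order is a scalar matrix,
   while its determinant is the coefficient of degree 2m of det g = 1. *)
Lemma Gr0_orbit_fixed_even (F : numFieldType) m : (0 < m)%N -> ~~ odd m ->
  Gr0_orbit_fixed F m = set0.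
Proof.
move=> m_gt0 /negbTE odd_m; rewrite -subset0 => g /Gr0_orbit_fixedP.
move=> [det_g g0 g_gt /eqP gm_neq0 sym_g]; apply: gm_neq0.
have det_gm : \det (loop_coef m g) = 0.
  have: (\det g)`_(m + m) = 0 by rewrite det_g coef1 (_ : _ == _ = false) //; lia.
  have coefMM (p q : {poly F}) : (size p <= m.+1)%N -> (size q <= m.+1)%N ->
      (p * q)`_(m + m) = p`_m * q`_m.
    move=> le_p le_q; rewrite coefM.
    have lt_m : (m < (m + m).+1)%N by lia.
    rewrite (bigD1 (Ordinal lt_m)) //= addnK big1 ?addr0 // => i ne_im.
    case: (ltngtP i m) => [lt_im|lt_mi|eq_im].
    - by rewrite [q`_ _]nth_default ?mulr0 // (leq_trans le_q) //; lia.
    - by rewrite [p`_ _]nth_default ?mul0r // (leq_trans le_p) //; lia.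
    - by case/eqP: ne_im; apply: val_inj.
  have /loop_coef_size le_g := g_gt.
  by rewrite !det_mx2 coefB !coefMM // !mxE.
have := sym_g m; rewrite -signr_odd odd_m expr0 scale1r.
move: (loop_coef m g) det_gm => C; rewrite det_mx2 => detC symC.
have C11 : C 1 1 = C 0 0.
  by move/matrixP/(_ 0 1): symC; rewrite !mulmx2E !mxE /= !Monoid.simpm.
have C10 : C 1 0 = 0.
  apply: eq_oppr0; move/matrixP/(_ 0 0): symC.
  by rewrite !mulmx2E !mxE /= !Monoid.simpm mulrN1.
have C01 : C 0 1 = 0.
  apply: eq_oppr0; move/matrixP/(_ 1 1): symC.
  by rewrite !mulmx2E !mxE /= !Monoid.simpm mulN1r => /esym.
move: detC; rewrite C11 C10 mulr0 subr0 => /eqP; rewrite mulf_eq0 orbb => /eqP C00.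
by apply: mx2P; rewrite mxE ?C11.
Qed.

(** * Jordan types *)

Section JordanType.
Variable F : fieldType.

Lemma jordan_blockX n k (i j : 'I_n) :
  (jordan_block F n ^+ k) i j = (i + k == j)%N%:R.
Proof.
elim: k i => [|k IHk] i; first by rewrite mxE addn0.
rewrite expmxS mxE.
case: (ltnP i.+1 n) => [lt_i|le_n].
  rewrite (bigD1 (Ordinal lt_i)) //= IHk mxE eqxx mul1r addSnnS big1 ?addr0 //.
  move=> l ne_l; rewrite mxE (_ : (i.+1 == l) = false) ?mul0r //.
  by apply: contraNF ne_l => /eqP eq_l; apply/eqP/val_inj.
rewrite big1 => [|l _].
  by rewrite (_ : (_ == _) = false) //; have := ltn_ord j; lia.
by rewrite mxE (_ : (i.+1 == l) = false) ?mul0r //; have := ltn_ord l; lia.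
Qed.

Lemma conj_expmx n (P A : 'M[F]_n) k : P \in unitmx ->
  (invmx P *m A *m P) ^+ k = invmx P *m A ^+ k *m P.
Proof.
move=> unitP; elim: k => [|k IHk]; first by rewrite mulmx1 mulVmx.
by rewrite !expmxS IHk !mulmxA mulmxK.
Qed.

Lemma similarP n (A B : 'M[F]_n) : A ~_{in unitmx} B <->
  exists2 P, P \in unitmx & A = invmx P *m B *m P.
Proof.
by split=> -[P unitP]; [move/(similarLR unitP) | move=> AE];
   exists P => //; [rewrite -conjVmx | apply/(similarLR unitP); rewrite conjVmx].
Qed.

(** For the converse, a row vector u with [u *m A ^+ n.-1 != 0] is cyclic: the rows [u *m A ^+ k]
    form a basis in which A is the Jordan block. *)
Lemma jordan_blockP n (A : 'M[F]_n) : (0 < n)%N ->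
  A ~_{in unitmx} jordan_block F n <-> A ^+ n = 0 /\ A ^+ n.-1 != 0.
Proof.
move=> n_gt0; split=> [/similarP[P unitP ->]|[A0 /matrix0Pn[i [j Aij]]]].
  rewrite !conj_expmx //; split.
    rewrite (_ : _ ^+ n = 0) ?mulmx0 ?mul0mx //.
    apply/matrixP=> i j; rewrite jordan_blockX mxE.
    by rewrite (_ : (_ == _) = false) //; have := ltn_ord j; lia.
  apply/eqP => /(congr1 (fun B => P *m B *m invmx P)).
  rewrite mulmx0 mul0mx !mulmxA mulmxV // mul1mx mulmxK //.
  have lt_n : (n.-1 < n)%N by lia.
  move/matrixP/(_ (Ordinal n_gt0) (Ordinal lt_n)).
  by rewrite jordan_blockX mxE /= add0n eqxx => /eqP; rewrite oner_eq0.
pose u := row i (1%:M : 'M[F]_n).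
have uA0 : u *m A ^+ n.-1 != 0.
  apply/eqP => /matrixP/(_ 0 j); rewrite -row_mul mul1mx !mxE.
  exact/eqP.
pose P : 'M[F]_n := \matrix_(k, l) (u *m A ^+ k) 0 l.
have rowPE k : row k P = u *m A ^+ k by apply/rowP=> l; rewrite !mxE.
have unitP : P \in unitmx.
  (* The coefficients of a relation vanish in increasing order: multiplying by [A ^+ (n.-1 - k)]
     kills all rows after the k-th. *)
  rewrite -row_free_unit; apply: inj_row_free => v vP0.
  apply/rowP=> k; rewrite mxE; have [d] := ubnP (nat_of_ord k).
  elim: d k => // d IHd k le_kd; have: v *m P *m A ^+ (n.-1 - k) = 0 by rewrite vP0 mul0mx.
  rewrite (mulmx_sum_row v) mulmx_suml (bigD1 k) //= big1 ?addr0.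
    rewrite -scalemxAl rowPE -mulmxA -expmxD subnKC; last by have := ltn_ord k; lia.
    by move/eqP; rewrite scaler_eq0 (negPf uA0) orbF => /eqP.
  move=> l ne_lk; rewrite -scalemxAl rowPE -mulmxA -expmxD.
  case: (ltngtP l k) => [lt_lk|lt_kl|eq_lk].
  - by rewrite (IHd l) ?scale0r //; lia.
  - by rewrite (expmx0_ge _ A0) ?mulmx0 ?scaler0 //; lia.
  - by case/eqP: ne_lk; apply: val_inj.
apply/similarP; exists P => //.
rewrite -[LHS](mulKmx unitP) -!mulmxA; congr (_ *m _).
apply/row_matrixP => k; rewrite !row_mul rowPE -mulmxA -expmxSr.
case: (ltnP k.+1 n) => [lt_k|le_n].
  rewrite (mulmx_sum_row (row k _)) (bigD1 (Ordinal lt_k)) //= !mxE /= eqxx scale1r rowPE.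
  rewrite big1 ?addr0 // => l ne_l.
  rewrite !mxE (_ : (_ == _) = false) ?scale0r //.
  by apply: contraNF ne_l => /eqP eq_l; apply/eqP/val_inj.
rewrite (expmx0_ge le_n A0) mulmx0 (mulmx_sum_row (row k _)) big1 // => l _.
by rewrite !mxE (_ : (_ == _) = false) ?scale0r //; have := ltn_ord l; lia.
Qed.

Lemma jordan_block_ker n p (v : 'M[F]_(n, p)) : (0 < n)%N ->
  jordan_block F n *m v = 0 -> exists w, v = jordan_block F n ^+ n.-1 *m w.
Proof.
move=> n_gt0 Jv0; have lt_n : (n.-1 < n)%N by lia.
(* Only the last row of w is seen by [jordan_block F n ^+ n.-1], which moves it to the first row. *)
exists (\matrix_(i, j) v (Ordinal n_gt0) j); apply/matrixP=> i j; rewrite mxE.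
under eq_bigr do rewrite jordan_blockX [X in _ * X]mxE.
case: (posnP i) => [i0|i_gt0].
  rewrite (bigD1 (Ordinal lt_n)) //= i0 eqxx mul1r big1 ?addr0.
    by congr (v _ _); apply: val_inj.
  move=> l ne_l; rewrite (_ : (_ == _) = false) ?mul0r //.
  by apply: contraNF ne_l => /eqP eq_l; apply/eqP/val_inj.
rewrite big1 => [|l _]; last first.
  by rewrite (_ : (_ == _) = false) ?mul0r //; have := ltn_ord l; lia.
have lt_i : (i.-1 < n)%N by have := ltn_ord i; lia.
move/matrixP/(_ (Ordinal lt_i) j): Jv0; rewrite mxE (bigD1 i) //= big1 ?addr0.
  by rewrite !mxE /= prednK // eqxx mul1r.
move=> l ne_l; rewrite mxE /= prednK // (_ : (_ == _) = false) ?mul0r //.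
by apply: contraNF ne_l => /eqP eq_l; apply/eqP/val_inj.
Qed.

(** The facts used about Jordan type (m,m): kernel vectors lie at the end of chains of length m, and
    T gives two kernel vectors whose independence is certified by T'. *)
Lemma jordan_type_mm_kernel m (x : 'M[F]_(m + m)) : (0 < m)%N ->
  jordan_type_mm x ->
  [/\ x ^+ m = 0,
      forall p (v : 'M[F]_(m + m, p)), x *m v = 0 ->
        exists w, v = x ^+ m.-1 *m w &
      exists (T : 'M[F]_(m + m, 2)) (T' : 'M[F]_(2, m + m)),
        x *m T = 0 /\ T' *m T = 1%:M].
Proof.
move=> m_gt0 /similarP[P unitP ->].
set J := jordan_block F m; set J2 := block_mx J 0 0 J.
have J2X k : J2 ^+ k = block_mx (J ^+ k) 0 0 (J ^+ k).
  elim: k => [|k IHk]; first exact: scalar_mx_block.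
  by rewrite !expmxS IHk mulmx_block !mulmx0 !mul0mx !addr0 add0r.
have Jm0 : J ^+ m = 0.
  apply/matrixP=> i j; rewrite jordan_blockX mxE.
  by rewrite (_ : (_ == _) = false) //; have := ltn_ord j; lia.
split.
- by rewrite conj_expmx // J2X Jm0 block_mx0 mulmx0 mul0mx.
- move=> p v /(congr1 (mulmx P)) Pxv0.
  have J2v : J2 *m (P *m v) = 0.
    by move: Pxv0; rewrite -!mulmxA mulKVmx // mulmx0.
  have: col_mx (J *m usubmx (P *m v)) (J *m dsubmx (P *m v)) = 0.
    by rewrite -J2v -[in RHS](vsubmxK (P *m v)) mul_block_col !mul0mx addr0 add0r.
  rewrite -[0 in RHS]col_mx0 => /eq_col_mx[].
  move=> /(jordan_block_ker m_gt0)[w1 w1E] /(jordan_block_ker m_gt0)[w2 w2E].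
  exists (invmx P *m col_mx w1 w2); rewrite conj_expmx // -!mulmxA mulKVmx //.
  rewrite J2X mul_block_col !mul0mx addr0 add0r -w1E -w2E vsubmxK.
  by rewrite mulKmx.
pose e : 'cV[F]_m := delta_mx (Ordinal m_gt0) 0.
have Je0 : J *m e = 0.
  apply/matrixP=> i j; rewrite !mxE big1 // => l _; rewrite !mxE.
  case: eqP => [eq_il|]; last by rewrite mul0r.
  by rewrite (_ : (l == _) = false) ?mulr0 //; apply/eqP => /(congr1 val) /=; lia.
have ee : e^T *m e = 1%:M.
  by rewrite trmx_delta mul_delta_mx; apply/matrixP=> i j; rewrite !ord1 !mxE.
have J2e : J2 *m block_mx e 0 0 e = 0.
  by rewrite mulmx_block !mulmx0 !mul0mx !addr0 add0r Je0 block_mx0.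
have ee2 : block_mx e^T 0 0 e^T *m block_mx e 0 0 e = 1%:M.
  by rewrite mulmx_block !mulmx0 !mul0mx !addr0 add0r ee -scalar_mx_block.
exists (invmx P *m (block_mx e 0 0 e : 'M_(m + m, 1 + 1))).
exists ((block_mx e^T 0 0 e^T : 'M_(1 + 1, m + m)) *m P); split.
  by rewrite -!mulmxA mulKVmx // J2e mulmx0.
by rewrite -mulmxA mulKVmx // ee2.
Qed.

End JordanType.

(** * Bases adapted to an sl2-triple *)

Section LowestWeight.
Variables (F : numFieldType) (m : nat).
Variables (x h y : 'M[F]_(m + m)).
Hypothesis m_gt0 : (0 < m)%N.
Hypothesis hx : mx_lie h x = x *+ 2.
Hypothesis hy : mx_lie h y = - (y *+ 2).
Hypothesis xy : mx_lie x y = h.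
Hypothesis x_nilp : x ^+ m = 0.

Let hxE : h *m x = x *m h + 2 *: x.
Proof. by move/eqP: hx; rewrite subr_eq addrC scaler_nat => /eqP. Qed.

Let hyE : h *m y = y *m h - 2 *: y.
Proof. by move/eqP: hy; rewrite subr_eq addrC scaler_nat => /eqP. Qed.

Let xyE : x *m y = y *m x + h.
Proof. by move/eqP: xy; rewrite subr_eq addrC => /eqP. Qed.

Lemma hxn k : h *m x ^+ k = x ^+ k *m h + (2 * k)%:R *: x ^+ k.
Proof.
elim: k => [|k IHk]; first by rewrite mulmx1 mul1mx scale0r addr0.
rewrite expmxS mulmxA hxE mulmxDl -mulmxA IHk -scalemxAl mulmxDr -scalemxAr.
by rewrite !mulmxA -addrA -scalerDl -natrD mulnS addnC.
Qed.

Lemma xny k :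
  x ^+ k.+1 *m y = y *m x ^+ k.+1 + k.+1%:R *: (x ^+ k *m h + k%:R *: x ^+ k).
Proof.
elim: k => [|k IHk].
  by rewrite !expr1 mul1mx scale0r addr0 scale1r.
rewrite expmxS -mulmxA IHk mulmxDr mulmxA xyE mulmxDl hxn -!mulmxA -!expmxS.
rewrite -addrA; congr (_ + _).
rewrite -scalemxAr mulmxDr -scalemxAr mulmxA -!expmxS !scalerDr !scalerA.
rewrite addrACA -[X in X + _ + _]scale1r -!scalerDl.
congr (_ + _ *: _).
by rewrite -!natrM -natrD; congr (_%:R); lia.
Qed.

(** With x ^+ m = 0, the commutation relation [xny] at the exponent m leaves x^(m-1) h = -(m-1)
    x^(m-1), and [hxn] moves h to the left. *)
Lemma xtop_h : h *m x ^+ m.-1 = m.-1%:R *: x ^+ m.-1.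
Proof.
have : x ^+ m.-1.+1 *m y = y *m x ^+ m.-1.+1 +
         m.-1.+1%:R *: (x ^+ m.-1 *m h + m.-1%:R *: x ^+ m.-1) by apply: xny.
rewrite prednK // x_nilp mul0mx mulmx0 add0r => /esym/eqP.
rewrite scaler_eq0 pnatr_eq0 gtn_eqF //= addrC addr_eq0 => /eqP xh.
rewrite hxn mulnC natrM mulr_natr -[x ^+ _ *m h]opprK -xh.
by rewrite mulr2n scalerDl addrA addNr add0r.
Qed.

Variables (T : 'M[F]_(m + m, 2)) (T' : 'M[F]_(2, m + m)).
Hypothesis x_ker : forall p (v : 'M[F]_(m + m, p)), x *m v = 0 ->
  exists w, v = x ^+ m.-1 *m w.
Hypothesis xT : x *m T = 0.
Hypothesis TT : T' *m T = 1%:M.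

Lemma ker_h p (v : 'M[F]_(m + m, p)) : x *m v = 0 -> h *m v = m.-1%:R *: v.
Proof. by case/x_ker=> w ->; rewrite mulmxA xtop_h scalemxAl. Qed.

Lemma hyT k : h *m (y ^+ k *m T) = (m.-1%:R - (2 * k)%:R) *: (y ^+ k *m T).
Proof.
elim: k => [|k IHk]; first by rewrite mul1mx subr0 ker_h.
rewrite expmxS -mulmxA mulmxA hyE mulmxBl -mulmxA IHk -scalemxAl -scalemxAr.
by rewrite -scalerBl -addrA -opprD -natrD mulnS addnC.
Qed.

Lemma xyT k :
  x *m (y ^+ k.+1 *m T) = (k.+1%:R * (m.-1%:R - k%:R)) *: (y ^+ k *m T).
Proof.
elim: k => [|k IHk].
  rewrite expr1 mulmxA xyE mulmxDl -mulmxA xT mulmx0 add0r ker_h //.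
  by rewrite mul1r subr0 mul1mx.
rewrite expmxS -mulmxA mulmxA xyE mulmxDl -mulmxA IHk hyT -scalemxAr.
rewrite mulmxA -expmxS -scalerDl; congr (_ *: _).
by rewrite natrM -[k.+2%:R]natr1 -[k.+1%:R]natr1; ring.
Qed.

(** By [xyT] this vector is killed by x, so it has weight m - 1 by [ker_h]; but [hyT] gives it the
    weight -(m + 1). *)
Lemma ymT : y ^+ m *m T = 0.
Proof.
have xymT : x *m (y ^+ m *m T) = 0.
  have := xyT m.-1; rewrite prednK // => ->.
  by rewrite subrr mulr0 scale0r.
have := hyT m; rewrite (ker_h xymT) => /eqP.
rewrite -subr_eq0 -scalerBl scaler_eq0 opprB addrC subrK pnatr_eq0.
by rewrite muln_eq0 /= gtn_eqF //= => /eqP.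
Qed.

Definition lowest : 'M[F]_(m + m, 2) := y ^+ m.-1 *m T.

Definition lowest_coef i : F := \prod_(k < i) sl2_coef F m k.+1.

Lemma lowest_coef_gt0 i : (i < m)%N -> 0 < lowest_coef i.
Proof.
move=> lt_im; apply: prodr_gt0 => k _; apply: (sl2_coef_gt0 F m_gt0).
by have := ltn_ord k; lia.
Qed.

Lemma x_lowest i : (i < m)%N ->
  x ^+ i *m lowest = lowest_coef i *: (y ^+ (m.-1 - i) *m T).
Proof.
elim: i => [|i IHi] lt_im.
  by rewrite /lowest_coef big_ord0 scale1r subn0 mul1mx.
rewrite expmxS -mulmxA IHi; last by lia.
rewrite -scalemxAr (_ : m.-1 - i = (m.-1 - i.+1).+1)%N; last by lia.
rewrite xyT scalerA /lowest_coef [in RHS]big_ord_recr /=; congr (_ * _ *: _).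
rewrite /sl2_coef mulrC natrM.
congr (_ * _); last by congr (_%:R); lia.
by rewrite -natrB; [congr (_%:R); lia | lia].
Qed.

Lemma y_lowest i : (i < m)%N ->
  y *m (x ^+ i *m lowest) = (i * (m - i))%:R *: (x ^+ i.-1 *m lowest).
Proof.
case: i => [|i] lt_im.
  by rewrite mul0n scale0r mul1mx mulmxA -expmxS prednK // ymT.
rewrite /= !x_lowest //; last by lia.
rewrite -scalemxAr mulmxA -expmxS scalerA.
rewrite (_ : m.-1 - i = (m.-1 - i.+1).+1)%N; last by lia.
by rewrite /lowest_coef big_ord_recr /= mulrC.
Qed.

Lemma yk_lowest k i : (i < m)%N -> (i < k)%N -> y ^+ k *m (x ^+ i *m lowest) = 0.
Proof.
elim: k i => // k IHk [|i] lt_im lt_ik; rewrite expmxSr -mulmxA y_lowest //.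
  by rewrite mul0n scale0r mulmx0.
by rewrite -scalemxAr IHk ?scaler0 //; lia.
Qed.

Definition colowest : 'M[F]_(2, m + m) := T' *m x ^+ m.-1 *m y ^+ m.-1.

(** For k < m.-1 the factor [y ^+ m.-1] of [colowest] kills [x ^+ k *m lowest], and for k >= m
    nilpotency of x does. At k = m.-1 one returns to a positive multiple of T, and c normalises
    it. *)
Lemma moment_lowest : exists2 c, c != 0 &
  forall k, moment (c *: colowest) lowest x k = (k == m.-1)%:R%:M.
Proof.
have lt_m1 : (m.-1 < m)%N by lia.
have ytop k : (k < m)%N -> exists2 d, 0 < d &
    y ^+ k *m (x ^+ k *m lowest) = d *: lowest.
  elim: k => [|k IHk] lt_km; first by exists 1; rewrite ?ltr01 // scale1r !mul1mx.
  have [|d d_gt0 dE] := IHk; first by lia.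
  exists ((k.+1 * (m - k.+1))%:R * d).
    by apply: mulr_gt0 => //; apply: (sl2_coef_gt0 F m_gt0); lia.
  by rewrite expmxSr -mulmxA y_lowest // -scalemxAr dE scalerA.
have [d d_gt0 dE] := ytop _ lt_m1.
have g_gt0 := lowest_coef_gt0 lt_m1.
exists (d * lowest_coef m.-1)^-1; first by rewrite invr_eq0 gt_eqF // mulr_gt0.
move=> k; rewrite /moment /colowest -!scalemxAl -!mulmxA.
case: (ltngtP k m.-1) => [lt_k|lt_k|->].
- by rewrite yk_lowest ?mulmx0 ?scaler0 ?raddf0 //; lia.
- by rewrite (expmx0_ge (_ : m <= k)%N x_nilp) ?mul0mx ?mulmx0 ?scaler0 ?raddf0 //; lia.
rewrite dE -!scalemxAr x_lowest // subnn mul1mx -scalemxAr TT.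
by rewrite !scalerA -?mulrA mulVf ?scale1r // gt_eqF // mulr_gt0.
Qed.

Lemma lowest_cosep n (A : 'M[F]_(n, m + m)) :
  (forall b, (b < m)%N -> A *m (x ^+ b *m lowest) = 0) -> A = 0.
Proof.
have [c c0 momE] := moment_lowest.
apply: (@krylov_cosep _ _ (c *: colowest)) => [k lt_k|]; rewrite momE.
  by rewrite ltn_eqF // raddf0.
by rewrite eqxx.
Qed.

End LowestWeight.

(** * Compatibility with the symplectic form *)

Section SymplecticTriple.
Variables (F : numFieldType) (m : nat).
Local Notation J := (symp_form F m).

Lemma symp_form_tr : J^T = - J.
Proof.
rewrite /symp_form tr_block_mx !trmx0 linearN /= trmx1.
by rewrite opp_block_mx !oppr0 opprK.
Qed.

Lemma symp_form_sqr : J *m J = - 1%:M.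
Proof.
rewrite /symp_form mulmx_block !mulmx0 !mul0mx !addr0 !add0r mul1mx mulmx1.
by rewrite [in RHS]scalar_mx_block opp_block_mx !oppr0.
Qed.

Lemma sp_trJ (z : 'M[F]_(m + m)) : sp F m z <-> z^T *m J = - (J *m z).
Proof.
rewrite /sp /=; split=> [/eqP|->]; last by rewrite addNr.
by rewrite addr_eq0 => /eqP.
Qed.

Lemma sp_exp_trJ (z : 'M[F]_(m + m)) k : sp F m z ->
  (z ^+ k)^T *m J = (-1) ^+ k *: (J *m z ^+ k).
Proof.
move=> /sp_trJ zJ; elim: k => [|k IHk].
  by rewrite trmx1 mul1mx mulmx1 scale1r.
rewrite expmxS trmx_mul -mulmxA zJ mulmxN mulmxA IHk -scalemxAl -mulmxA -expmxSr.
by rewrite (exprS (-1)) mulN1r scaleNr -expmxS.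
Qed.

(** The factor [- S2] makes the moment of order m.-1 the identity when the pairing of E with
    [x ^+ m.-1 *m E] is [S2]. *)
Definition form_dual (E : 'M[F]_(m + m, 2)) : 'M[F]_(2, m + m) :=
  - (S2 *m (E^T *m J)).

(** The lowest weight vectors [E0] are rescaled so that the form (u, v) -> u^T J x^(m-1) v has
    matrix [S2] on them; m odd makes this form skew. *)
Lemma sp_slice_basis (x h y : 'M[F]_(m + m)) : odd m ->
    jordan_type_mm x -> sp_sl2_triple x h y ->
  exists E : 'M[F]_(m + m, 2),
    [/\ x ^+ m = 0,
        forall k, moment (form_dual E) E x k = (k == m.-1)%:R%:M &
        forall i, (i < m)%N ->
          y *m (x ^+ i *m E) = (i * (m - i))%:R *: (x ^+ i.-1 *m E)].
Proof.
move=> odd_m xmm [[sp_x _ sp_y] [hx hy xy]].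
have m_gt0 : (0 < m)%N by lia.
have [x_nilp x_ker [T [T' [xT TT]]]] := jordan_type_mm_kernel m_gt0 xmm.
have yE0 := y_lowest m_gt0 hx hy xy x_nilp x_ker xT.
have [c c_neq0 momE] := moment_lowest m_gt0 hx hy xy x_nilp x_ker xT TT.
have cosep := lowest_cosep m_gt0 hx hy xy x_nilp x_ker xT TT.
move: (lowest y T) yE0 momE cosep => E0 yE0 momE cosep.
have E0Jy : E0^T *m J *m y = 0.
  apply: trmx_inj; rewrite !trmx_mul trmxK trmx0 symp_form_tr mulNmx mulmxN.
  have /sp_trJ := sp_y; rewrite mulmxA => ->.
  rewrite mulNmx opprK -mulmxA.
  by have := yE0 0%N m_gt0; rewrite mul0n scale0r mul1mx => ->; rewrite mulmx0.
pose Om k := E0^T *m J *m (x ^+ k *m E0).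
have Om_ge k : (m <= k)%N -> Om k = 0.
  by move=> le_mk; rewrite /Om (expmx0_ge le_mk x_nilp) mul0mx mulmx0.
(* Here [x ^+ k *m E0] is a multiple of [y *m (x ^+ k.+1 *m E0)], and y is absorbed by [E0Jy]. *)
have Om_lt k : (k < m.-1)%N -> Om k = 0.
  move=> lt_k; have lt_k1 : (k.+1 < m)%N by lia.
  have cf : (k.+1 * (m - k.+1))%:R != 0 :> F.
    by rewrite pnatr_eq0 muln_eq0; lia.
  apply: (scalerI cf); rewrite scaler0 /Om scalemxAr -(yE0 k.+1) //.
  by rewrite (mulmxA _ y) E0Jy mul0mx.
have Om_tr : (Om m.-1)^T = - Om m.-1.
  rewrite /Om !trmx_mul trmxK symp_form_tr -!mulmxA mulNmx !mulmxN.
  rewrite (mulmxA _ J) sp_exp_trJ // -signr_odd (_ : odd m.-1 = false) ?scale1r.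
    by rewrite !mulmxA.
  by case: (m) m_gt0 odd_m => //= k _ /negbTE.
pose w := Om m.-1 0 1.
have Om_top : Om m.-1 = w *: S2.
  apply: mx2P; rewrite [RHS]mxE [S2 _ _]mxE /= ?mulr0 ?mulr1 ?mulrN1 //.
  - by apply: eq_oppr0; move/matrixP/(_ 0 0): Om_tr; rewrite [LHS]mxE [RHS]mxE.
  - by move/matrixP/(_ 0 1): Om_tr; rewrite [LHS]mxE [RHS]mxE.
  - by apply: eq_oppr0; move/matrixP/(_ 1 1): Om_tr; rewrite [LHS]mxE [RHS]mxE.
(* If w were 0, [E0^T *m J] would kill the whole Krylov basis, and J invertible would give E0 =
   0. *)
have w_neq0 : w != 0.
  apply/eqP => w0; have E0J0 : E0^T *m J = 0.
    apply: cosep => b lt_bm; case: (ltngtP b m.-1) => lt_b.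
    - exact: Om_lt.
    - by apply: Om_ge; lia.
    - by rewrite lt_b [LHS]Om_top w0 scale0r.
  have E00 : E0 = 0.
    apply: trmx_inj; rewrite trmx0 -[LHS]opprK -[E0^T]mulmx1 -mulmxN.
    by rewrite -symp_form_sqr mulmxA E0J0 mul0mx oppr0.
  have := momE m.-1; rewrite E00 /moment mulmx0 eqxx => /esym/matrixP/(_ 0 0).
  by rewrite !mxE => /eqP; rewrite oner_eq0.
(* By [S2_congr] a change of basis scales the form by its determinant, so determinant w^-1 is what
   is needed. *)
pose D : 'M[F]_2 := mx2 1 0 0 w^-1.
have OmD k : moment (form_dual (E0 *m D)) (E0 *m D) x k = - (S2 *m (D^T *m Om k *m D)).
  by rewrite /moment /form_dual !mulNmx trmx_mul !mulmxA.
exists (E0 *m D); split=> // [k|i lt_im]; last first.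
  by rewrite (mulmxA (x ^+ i)) (mulmxA y) yE0 // -scalemxAl -mulmxA.
rewrite OmD; case: (ltngtP k m.-1) => [lt_k|lt_k|->].
- by rewrite Om_lt // mulmx0 mul0mx mulmx0 oppr0 raddf0.
- by rewrite Om_ge ?mulmx0 ?mul0mx ?mulmx0 ?oppr0 ?raddf0 //; lia.
rewrite Om_top -scalemxAr -scalemxAl S2_congr det_mx2 !mxE /=.
by rewrite mulr0 subr0 mul1r scalerA divff // scale1r S2_sqr opprK.
Qed.

End SymplecticTriple.

(** * Polynomial functions *)

Section PolynomialFunctions.
Variables (F : fieldType) (I T : Type) (c : I -> T -> F).

Definition polyfun (f : T -> F) : Prop :=
  exists n (s : 'I_n -> I) (p : {mpoly F[n]}),
    forall t, f t = p.@[point_coords c s t].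

Lemma polyfun_regular X f : polyfun f -> regular_on c X f.
Proof.
move=> [n [s [p fE]]] t _; exists n, s, p, 1; rewrite meval1 oner_neq0.
by split=> // u _ _; rewrite meval1 divr1.
Qed.

Lemma polyfun_ext f g : f =1 g -> polyfun f -> polyfun g.
Proof. by move=> eq_fg [n [s [p fE]]]; exists n, s, p => t; rewrite -eq_fg. Qed.

Lemma polyfun_const a : polyfun (fun=> a).
Proof.
by exists 0%N, (fun i : 'I_0 => match notF (ltn_ord i) with end), a%:MP => t;
   rewrite mevalC.
Qed.

Lemma polyfun_coord i : polyfun (c i).
Proof. by exists 1%N, (fun=> i), 'X_0 => t; rewrite mevalXU. Qed.

Lemma polyfun_common f g : polyfun f -> polyfun g ->
  exists n (s : 'I_n -> I) (p q : {mpoly F[n]}),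
    (forall t, f t = p.@[point_coords c s t]) /\
    (forall t, g t = q.@[point_coords c s t]).
Proof.
move=> [n1 [s1 [p fE]]] [n2 [s2 [q gE]]].
pose s k := match split k with inl a => s1 a | inr b => s2 b end.
exists (n1 + n2)%N, s.
exists (p \mPo [tuple 'X_(lshift n2 i) | i < n1]).
exists (q \mPo [tuple 'X_(rshift n1 i) | i < n2]).
split=> t; rewrite comp_mpoly_meval ?fE ?gE; apply: meval_eq => i;
  rewrite tnth_mktuple mevalXU /point_coords /s.
  by rewrite (unsplitK (inl i)).
by rewrite (unsplitK (inr i)).
Qed.

Lemma polyfunD f g : polyfun f -> polyfun g -> polyfun (fun t => f t + g t).
Proof.
move=> pf pg; have [n [s [p [q [fE gE]]]]] := polyfun_common pf pg.
by exists n, s, (p + q) => t; rewrite mevalD fE gE.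
Qed.

Lemma polyfunM f g : polyfun f -> polyfun g -> polyfun (fun t => f t * g t).
Proof.
move=> pf pg; have [n [s [p [q [fE gE]]]]] := polyfun_common pf pg.
by exists n, s, (p * q) => t; rewrite mevalM fE gE.
Qed.

Lemma polyfun_sum (K : Type) (r : seq K) (f : K -> T -> F) :
  (forall k, polyfun (f k)) -> polyfun (fun t => \sum_(k <- r) f k t).
Proof.
move=> pf; elim: r => [|k r IHr].
  by apply: (polyfun_ext _ (polyfun_const 0)) => t; rewrite big_nil.
apply: (polyfun_ext _ (polyfunD (pf k) IHr)) => t.
by rewrite big_cons.
Qed.

Definition polyfun_mx n p (A : T -> 'M[F]_(n, p)) : Prop :=
  forall i j, polyfun (fun t => A t i j).

Lemma polyfun_mx_const n p (A : 'M[F]_(n, p)) : polyfun_mx (fun=> A).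
Proof. by move=> i j; apply: polyfun_const. Qed.

Lemma polyfun_mxD n p (A B : T -> 'M[F]_(n, p)) :
  polyfun_mx A -> polyfun_mx B -> polyfun_mx (fun t => A t + B t).
Proof.
move=> pA pB i j; apply: (polyfun_ext _ (polyfunD (pA i j) (pB i j))) => t.
by rewrite mxE.
Qed.

Lemma polyfun_mxZ n p a (A : T -> 'M[F]_(n, p)) :
  polyfun_mx A -> polyfun_mx (fun t => a *: A t).
Proof.
move=> pA i j; apply: (polyfun_ext _ (polyfunM (polyfun_const a) (pA i j))) => t.
by rewrite mxE.
Qed.

Lemma polyfun_mxM n p q (A : T -> 'M[F]_(n, p)) (B : T -> 'M[F]_(p, q)) :
  polyfun_mx A -> polyfun_mx B -> polyfun_mx (fun t => A t *m B t).
Proof.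
move=> pA pB i j; have pAB k := polyfunM (pA i k) (pB k j).
by apply: (polyfun_ext _ (polyfun_sum _ pAB)) => t; rewrite mxE.
Qed.

Lemma polyfun_mx_sum (K : Type) (r : seq K) n p (A : K -> T -> 'M[F]_(n, p)) :
  (forall k, polyfun_mx (A k)) -> polyfun_mx (fun t => \sum_(k <- r) A k t).
Proof.
move=> pA i j; apply: (polyfun_ext _ (polyfun_sum r (fun k => pA k i j))) => t.
by rewrite summxE.
Qed.

Lemma polyfun_mxX n (A : T -> 'M[F]_n) k :
  polyfun_mx A -> polyfun_mx (fun t => A t ^+ k).
Proof.
move=> pA; elim: k => [|k IHk]; first exact: polyfun_mx_const.
move=> i j; apply: (polyfun_ext _ (polyfun_mxM pA IHk i j)) => t.
by rewrite expmxS.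
Qed.

Lemma polyfun_moment m Phi E (M : T -> 'M[F]_(m + m)) k :
  polyfun_mx M -> polyfun_mx (fun t => moment Phi E (M t) k).
Proof.
move=> pM; apply: polyfun_mxM (polyfun_mx_const E).
exact: polyfun_mxM (polyfun_mx_const Phi) (polyfun_mxX k pM).
Qed.

End PolynomialFunctions.

(** Each correction divides only by constants independent of G, so the recursion stays
    polynomial. *)
Lemma polyfun_slice_solve (F : numFieldType) (I T : Type) (c : I -> T -> F)
    m Phi E (x y : 'M[F]_(m + m)) (G : nat -> T -> 'M[F]_2) k :
  (forall j, polyfun_mx c (G j)) ->
  polyfun_mx c (fun t => slice_solve Phi E x y (fun j => G j t) k).
Proof.
move=> pG; elim: k => [|k IHk] /=; first exact: polyfun_mx_const.
apply: polyfun_mxD => //; apply: polyfun_mxM; first exact: polyfun_mx_const.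
apply: polyfun_mx_sum => i; apply: polyfun_mxM (polyfun_mx_const _ _).
apply: polyfun_mxM (polyfun_mx_const _ _).
apply: polyfun_mxM; first exact: polyfun_mx_const.
apply: polyfun_mxZ; apply: polyfun_mxD => // i1 j1.
apply: (polyfun_ext _ (polyfun_mxZ (-1) (polyfun_moment Phi E (m + k) IHk) i1 j1)).
by move=> t; rewrite scaleN1r.
Qed.

(** * The isomorphism *)

Section SliceIsomorphism.
Variables (F : numFieldType) (m : nat) (x h y : 'M[F]_(m + m)).
Variable E : 'M[F]_(m + m, 2).
Local Notation J := (symp_form F m).
Local Notation Phi := (form_dual E).
Local Notation mom := (moment Phi E).

Hypothesis odd_m : odd m.
Hypothesis sp_x : sp F m x.
Hypothesis sp_y : sp F m y.
Hypothesis x_nilp : x ^+ m = 0.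
Hypothesis moment_x : forall k, mom x k = (k == m.-1)%:R%:M.
Hypothesis yxE : forall i, (i < m)%N ->
  y *m (x ^+ i *m E) = (i * (m - i))%:R *: (x ^+ i.-1 *m E).

Let m_gt0 : (0 < m)%N. Proof. by case: (m) odd_m. Qed.

Definition slice_to_loop (M : 'M[F]_(m + m)) : 'M[{poly F}]_2 :=
  loop_of (fun j => mom M (m.-1 + j)) m.

Definition loop_to_slice (g : 'M[{poly F}]_2) : 'M[F]_(m + m) :=
  slice_solve Phi E x y (fun j => loop_coef j g) m.

(** Minus the adjoint for the symplectic form, as the inverse of J is -J. *)
Definition sp_adj (z : 'M[F]_(m + m)) : 'M[F]_(m + m) := J *m z^T *m J.

Lemma sp_adjP z : sp F m z <-> sp_adj z = z.
Proof.
rewrite sp_trJ /sp_adj -mulmxA; split=> [->|zE].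
  by rewrite mulmxN mulmxA symp_form_sqr mulNmx opprK mul1mx.
by rewrite -{2}zE mulmxA symp_form_sqr mulNmx opprK mul1mx.
Qed.

Lemma sp_adjB z w : sp_adj (z - w) = sp_adj z - sp_adj w.
Proof. by rewrite /sp_adj linearB /= mulmxBr mulmxBl. Qed.

Lemma sp_adj_comm z : y *m z = z *m y -> y *m sp_adj z = sp_adj z *m y.
Proof.
move=> comm_z; have yJ : y *m J = - (J *m y^T).
  have /sp_adjP yE := sp_y; rewrite -{1}yE /sp_adj -!mulmxA symp_form_sqr.
  by rewrite mulmxN mulmx1 mulmxN.
have /sp_trJ Jy := sp_y.
rewrite /sp_adj !mulmxA yJ !mulNmx -(mulmxA _ J y) -[J *m y]opprK -Jy.
rewrite mulmxN -!mulmxA; congr (- (_ *m _)).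
by rewrite !mulmxA -!trmx_mul comm_z.
Qed.

(** Transposing a moment moves M across the form, each factor contributing a sign, and exchanges
    [Phi] and [E] up to [S2]. *)
Lemma moment_sp_adj M k :
  S2 *m mom (sp_adj M) k = (-1) ^+ k *: ((mom M k)^T *m S2).
Proof.
have JadjX : J *m sp_adj M ^+ k = (-1) ^+ k *: ((M ^+ k)^T *m J).
  elim: k => [|k IHk]; first by rewrite mulmx1 trmx1 mul1mx scale1r.
  rewrite expmxSr mulmxA IHk -scalemxAl /sp_adj -!mulmxA (mulmxA J J).
  rewrite symp_form_sqr mulNmx mul1mx mulmxN mulmxA -trmx_mul -expmxS.
  by rewrite [in RHS]exprS mulN1r scaleNr scalerN.
have S2Phi : S2 *m Phi = E^T *m J.
  by rewrite /form_dual mulmxN mulmxA S2_sqr mulNmx opprK mul1mx.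
have PhiS2 : Phi^T *m S2 = J *m E.
  have /(congr1 trmx) := S2Phi; rewrite !trmx_mul trmxK symp_form_tr S2_tr.
  by rewrite mulmxN mulNmx => /oppr_inj.
rewrite /moment mulmxA mulmxA S2Phi -(mulmxA _ J) JadjX -scalemxAr -scalemxAl.
by rewrite !trmx_mul -(mulmxA _ _ S2) -(mulmxA _ _ S2) PhiS2 !mulmxA.
Qed.

Lemma moment_sp M k : sp F m M ->
  S2 *m mom M k = (-1) ^+ k *: ((mom M k)^T *m S2).
Proof. by move=> /sp_adjP ME; rewrite -moment_sp_adj ME. Qed.

(** Moments of order below m are constant along the slice, so the Krylov lemmas apply at each of its
    points. *)
Lemma moment_slice z : y *m z = z *m y ->
  (forall k, (k < m.-1)%N -> mom (x + z) k = 0) /\ mom (x + z) m.-1 = 1%:M.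
Proof.
move=> comm_z; have z0 := comm_filt0 m_gt0 x_nilp moment_x yxE comm_z.
have momE k : (k < m)%N -> mom (x + z) k = (k == m.-1)%:R%:M.
  by move=> lt_km; rewrite (moment_low m_gt0 moment_x z0 lt_km).
split=> [k lt_k|]; last by rewrite momE ?eqxx //; lia.
rewrite momE; last by lia.
by rewrite ltn_eqF // raddf0.
Qed.

Lemma sign_top j : (-1) ^+ (m.-1 + j) = (-1) ^+ j :> F.
Proof.
rewrite exprD -signr_odd (_ : odd m.-1 = false) ?mul1r //.
by case: (m) m_gt0 odd_m => //= k _ /negbTE.
Qed.

Lemma slice_orbitP M :
  (sp_regular_nilpotent_orbit F m `&` sp_slodowy_slice x y) M <->
  [/\ sp F m M, y *m (M - x) = (M - x) *m y, M ^+ (m + m) = 0 &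
      M ^+ (m + m).-1 != 0].
Proof.
have mm_gt0 : (0 < m + m)%N by lia.
split=> [[[sp_M /(jordan_blockP _ mm_gt0)[M0 M_neq0]] [z [_ comm_z] ME]]|].
  split=> //; rewrite -ME [x + z]addrC addrK.
  by apply/eqP; rewrite -subr_eq0 -/(mx_lie y z) comm_z.
move=> [sp_M comm_z M0 M_neq0]; split.
  by split=> //; apply/(jordan_blockP _ mm_gt0).
exists (M - x); last by rewrite subrKC.
split; last by rewrite /mx_lie comm_z subrr.
by apply/sp_adjP; rewrite sp_adjB; congr (_ - _); apply/sp_adjP.
Qed.

Lemma slice_to_loop_coef M j : (j <= m)%N ->
  loop_coef j (slice_to_loop M) = mom M (m.-1 + j).
Proof. exact: loop_ofK. Qed.

Lemma slice_to_loop_fixed M :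
  (sp_regular_nilpotent_orbit F m `&` sp_slodowy_slice x y) M ->
  Gr0_orbit_fixed F m (slice_to_loop M).
Proof.
move=> /slice_orbitP[sp_M comm_z M0 M_neq0].
have [] := moment_slice comm_z; rewrite subrKC => mom_lt mom_eq.
apply/Gr0_orbit_fixedP; split.
- exact: regular_nilpotent_det.
- by rewrite slice_to_loop_coef // addn0.
- by move=> j lt_mj; apply: loop_of_gt.
- rewrite slice_to_loop_coef // (_ : m.-1 + m = (m + m).-1)%N; last by lia.
  exact: regular_nilpotent_moment M_neq0.
move=> j; case: (leqP j m) => [le_jm|lt_mj].
  by rewrite slice_to_loop_coef // moment_sp // sign_top.
by rewrite loop_of_gt // mulmx0 trmx0 mul0mx scaler0.
Qed.

Lemma loop_to_slice_comm g :
  y *m (loop_to_slice g - x) = (loop_to_slice g - x) *m y.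
Proof. exact: slice_solve_comm. Qed.

Section LoopToSlice.
Variable g : 'M[{poly F}]_2.
Hypothesis g_fixed : Gr0_orbit_fixed F m g.
Local Notation M := (loop_to_slice g).

Lemma loop_to_slice_moment j : (j <= m)%N -> loop_coef j g = mom M (m.-1 + j).
Proof.
have /Gr0_orbit_fixedP[_ g0 _ _ _] := g_fixed.
have [_] := moment_slice (loop_to_slice_comm g); rewrite subrKC => mom_eq.
case: j => [|j] le_jm; first by rewrite addn0 mom_eq.
rewrite (_ : m.-1 + j.+1 = m + j)%N; last by lia.
by rewrite (slice_solve_moment m_gt0 x_nilp moment_x yxE).
Qed.

(* M and its symplectic adjoint have the same moments. *)
Lemma loop_to_slice_sp : sp F m M.
Proof.
have /Gr0_orbit_fixedP[_ _ _ _ sym_g] := g_fixed.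
apply/sp_adjP/esym/(addIr (- x)).
have sp_adjx : sp_adj x = x by apply/sp_adjP.
rewrite -{2}sp_adjx -sp_adjB.
have comm_z := loop_to_slice_comm g.
apply: (slice_moment_inj m_gt0 x_nilp moment_x yxE comm_z (sp_adj_comm comm_z)).
move=> j lt_jm; rewrite sp_adjB sp_adjx !subrKC.
have mj : (m + j = m.-1 + j.+1)%N by lia.
have S2K : - S2 *m S2 = 1%:M :> 'M[F]_2 by rewrite mulNmx S2_sqr opprK.
rewrite -[LHS]mul1mx -[RHS]mul1mx -S2K -!mulmxA; congr (_ *m _).
by rewrite moment_sp_adj mj sign_top -loop_to_slice_moment // sym_g.
Qed.

Lemma loop_to_slice_orbit :
  (sp_regular_nilpotent_orbit F m `&` sp_slodowy_slice x y) M.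
Proof.
have /Gr0_orbit_fixedP[det_g g0 g_gt gm _] := g_fixed.
have comm_z := loop_to_slice_comm g.
have [] := moment_slice comm_z; rewrite subrKC => mom_lt mom_eq.
(* The inverse of g in determinant 1, written through [S2] so that its coefficients visibly vanish
   beyond m. *)
pose g' := - (S2 *m g^T *m S2).
have gg' : g *m g' = 1%:M.
  rewrite /g' mulmxN !mulmxA -{1}[g]trmxK S2_congr det_tr det_g scale1r.
  by rewrite S2_sqr opprK.
have g'E j : loop_coef j g' = - (S2 *m (loop_coef j g)^T *m S2).
  rewrite -loop_coef_tr -loop_coef_S2l -loop_coef_S2r.
  by apply/matrixP=> i k; rewrite !mxE coefN.
have g'0 : loop_coef 0 g' = 1%:M.
  by rewrite g'E g0 trmx1 mulmx1 S2_sqr opprK.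
have g'_gt j : (m < j)%N -> loop_coef j g' = 0.
  by move=> lt_mj; rewrite g'E g_gt // trmx0 mulmx0 mul0mx oppr0.
have momE := moment_inverse m_gt0 mom_lt mom_eq gg' g'0 g'_gt loop_to_slice_moment.
apply/slice_orbitP; split=> //; first exact: loop_to_slice_sp.
  (* Every entry of [M ^+ (m + m)] is a coefficient of g of degree above m. *)
  apply: (krylov_eq0 mom_lt mom_eq) => a b _ _; rewrite moment_sandwich.
  rewrite (_ : a + (m + m) + b = m.-1 + (a + b + m.+1))%N; last by lia.
  by rewrite momE g_gt //; lia.
apply: contraNneq gm => M0; rewrite loop_to_slice_moment //.
rewrite (_ : m.-1 + m = (m + m).-1)%N; last by lia.
by rewrite /moment M0 mulmx0 mul0mx.
Qed.

Lemma loop_to_sliceK : slice_to_loop M = g.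
Proof.
have /Gr0_orbit_fixedP[_ _ g_gt _ _] := g_fixed.
apply: loop_coef_inj => j; case: (leqP j m) => [le_jm|lt_mj].
  by rewrite slice_to_loop_coef // -loop_to_slice_moment.
by rewrite g_gt // loop_of_gt.
Qed.

End LoopToSlice.

Lemma slice_to_loopK M :
  (sp_regular_nilpotent_orbit F m `&` sp_slodowy_slice x y) M ->
  loop_to_slice (slice_to_loop M) = M.
Proof.
move=> YM; have fixedM := slice_to_loop_fixed YM.
have /slice_orbitP[_ comm_z _ _] := YM.
apply: (addIr (- x)).
have comm_w := loop_to_slice_comm (slice_to_loop M).
apply: (slice_moment_inj m_gt0 x_nilp moment_x yxE comm_w comm_z) => j lt_jm.
rewrite !subrKC (_ : m + j = m.-1 + j.+1)%N; last by lia.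
by rewrite -loop_to_slice_moment // slice_to_loop_coef.
Qed.

Lemma fixed_slice_isomorphic :
  isomorphic_varieties (@loop_coord F) (@mx_coord F (m + m))
    (Gr0_orbit_fixed F m)
    (sp_regular_nilpotent_orbit F m `&` sp_slodowy_slice x y).
Proof.
exists loop_to_slice, slice_to_loop; split.
- split=> [g|[i j]]; first exact: loop_to_slice_orbit.
  apply: polyfun_regular; apply: polyfun_slice_solve => k a b.
  apply: (polyfun_ext _ (polyfun_coord _ (k, (a, b)))) => g.
  by rewrite /loop_coord mxE.
- split=> [M|[k [i j]]]; first exact: slice_to_loop_fixed.
  apply: polyfun_regular.
  have pM : polyfun_mx (@mx_coord F (m + m)) id.
    by move=> a b; apply: (polyfun_coord _ (a, b)).
  case: (leqP k m) => [le_km|lt_mk].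
    apply: (polyfun_ext _ (polyfun_moment Phi E (m.-1 + k) pM i j)) => M.
    by rewrite -slice_to_loop_coef // mxE.
  (* The loop space has infinitely many coordinates, but those of degree above m are constantly 0 on
     the image. *)
  apply: (polyfun_ext _ (polyfun_const _ 0)) => M.
  have /matrixP/(_ i j) := loop_of_gt (fun j => mom M (m.-1 + j)) lt_mk.
  by rewrite [LHS]mxE [RHS]mxE => <-.
- exact: loop_to_sliceK.
- exact: slice_to_loopK.
Qed.

End SliceIsomorphism.

Theorem theorem1p5 (R : realType) (m : nat) (hm : (0 < m)%N) :
  (~~ odd m -> Gr0_orbit_fixed R[i] m = set0) /\
  (odd m ->
   forall x h y : 'M[R[i]]_(m + m),
     jordan_type_mm x -> sp_sl2_triple x h y ->
     isomorphic_varieties (@loop_coord R[i]) (@mx_coord R[i] (m + m))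
       (Gr0_orbit_fixed R[i] m)
       (sp_regular_nilpotent_orbit R[i] m `&` sp_slodowy_slice x y)).
Proof.
split=> [even_m|odd_m x h y x_mm xhy].
  exact: (@Gr0_orbit_fixed_even R[i] m hm even_m).
have [E [x_nilp moment_x yxE]] := @sp_slice_basis R[i] m x h y odd_m x_mm xhy.
have [[sp_x _ sp_y] _] := xhy.
exact: (@fixed_slice_isomorphic R[i] m x y E).
Qed.
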